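(* Let $S(q)=\dfrac{1}{(q;q^8)_\infty(q^4;q^8)_\infty(q^7;q^8)_\infty}$ and $T(q)=\dfrac{1}{(q^3;q^8)_\infty(q^4;q^8)_\infty(q^5;q^8)_\infty}$. For a positive integer $k$ define power series (sums over $n\ge0$) \[ \sum\rho_{1,k}(n)q^n=\frac{S^k(q)}{T^k(q)},\quad \sum\rho_{2,k}(n)q^n=\frac{T(q)S(q^k)}{S(q)T(q^k)},\quad \sum\rho_{3,k}(n)q^n=\frac{S(q)S(q^k)}{T(q)T(q^k)}, \] \[ \sum\rho_{4}(n)q^n=\frac{T(q^2)S(q^4)}{S(q^2)T(q^4)},\quad \sum\rho_{5,k}(n)q^n=\frac{S^k(-q)T^k(q)S^k(q^4)}{S^k(q)T^k(-q)T^k(q^4)},\quad \sum\rho_{6}(n)q^n=\frac{S(-q)T(q^2)S(q^3)}{T(-q)S(q^2)T(q^3)}, \] \[ \sum\rho_{7}(n)q^n=\frac{T(-q)T(q^2)S(q^3)}{S(-q)S(q^2)T(q^3)},\quad \sum\rho_{8}(n)q^n=\frac{S(q)S(-q^3)S(q^6)}{T(q)T(-q^3)T(q^6)},\quad \sum\rho_{9}(n)q^n=\frac{S(q)T(-q^3)S(q^6)}{T(q)S(-q^3)T(q^6)}, \] and denote by a prime (e.g. $\rho'_{1,k}(n)$) the coefficient of $q^n$ in the reciprocal of the corresponding series. Then for all $n\ge0$: (i) $\rho_{1,1}(2n+1)=\rho'_{1,1}(2n)$; (ii) $\rho_{1,1}(4n+2)=-\rho'_{1,1}(4n+1)$; (iii)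 $\rho_{1,2}(2n+3)=-\rho'_{1,2}(2n+1)$; (iv) $\rho_{1,2}(8n+4)=\rho'_{1,2}(8n+2)$; (v) $\rho_{1,2}(8n+6)=\rho'_{1,2}(8n+4)$; (vi) $\rho_{1,4}(4n+6)=\rho'_{1,2}(4n+2)$; (vii) $\rho_{2,3}(4n+5)=-\rho'_{2,3}(4n+3)$; (viii) $\rho_{2,5}(4n+6)=-\rho'_{2,5}(4n+2)$; (ix) $\rho_{2,7}(4n+7)=-\rho'_{2,7}(4n+1)$; (x) $\rho_{2,9}(4n+10)=-\rho'_{2,9}(4n+2)$; (xi) $\rho_{3,3}(4n+6)=-\rho'_{3,3}(4n+2)$; (xii) $\rho_{3,5}(4n+7)=-\rho'_{3,5}(4n+1)$; (xiii) $\rho_{3,9}(4n+11)=-\rho'_{3,9}(4n+1)$; (xiv) $\rho_4(4n+2)=-\rho'_4(4n)$; (xv) $\rho_{5,1}(4n+6)=-\rho'_{5,1}(4n+2)$; (xvi) $\rho_{5,1}(4n+7)=\rho'_{5,1}(4n+3)$; (xvii) $\rho_{5,1}(8n+4)=-\rho'_{5,1}(8n)$; (xviii) $\rho_{5,1}(8n+5)=\rho'_{5,1}(8n+1)$; (xix) $\rho_{5,2}(8n+12)=-\rho'_{5,2}(8n+4)$; (xx) $\rho_6(4n+5)=-\rho'_6(4n+3)$; (xxi) $\rho_7(8n)=-\rho'_7(8n)$; (xxii) $\rho_8(8n+13)=-\rho'_8(8n+3)$; (xxiii) $\rho_9(4n+6)=-\rho'_9(4n+2)$.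
   Context: $(a;q)_\infty=\prod_{j\ge0}(1-aq^j)$, $q$ a formal variable (or complex with $|q|<1$). $S(q),T(q)$ are the Ramanujan–Göllnitz–Gordon functions in product form; all series above have constant term $1$.
   Formalization: Item (vi) is false as printed (at n=0 it reads -6=1) and is proved as ρ_{1,4}(4n+6) = -ρ'_{1,4}(4n+2); item (xxi) is false at n=0 (it reads 1=-1) and is proved for n≥1. *)

(* Defs.v *)
From HB Require Import structures.
From mathcomp Require Import all_boot all_order all_algebra.
From mathcomp Require Import boolp.

Set Implicit Arguments.
Unset Strict Implicit.
Unset Printing Implicit Defensive.

Import GRing.Theory.
Local Open Scope ring_scope.

Record fps (R : Type) := Fps { fcoef :> nat -> R }.

Lemma fpsP (R : Type) (f g : fps R) : (forall n, f n = g n) -> f = g.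
Proof. by case: f g => [f] [g] /= fg; congr Fps; apply: funext. Qed.

HB.instance Definition _ (R : Type) := gen_eqMixin (fps R).
HB.instance Definition _ (R : Type) := gen_choiceMixin (fps R).

Section FpsRing.
Variable R : comNzRingType.
Implicit Types f g h : fps R.

Definition fps_zero : fps R := Fps (fun _ => 0).
Definition fps_opp f : fps R := Fps (fun n => - f n).
Definition fps_add f g : fps R := Fps (fun n => f n + g n).
Definition fps_one : fps R := Fps (fun n => (n == 0%N)%:R).
Definition fps_mul f g : fps R :=
  Fps (fun n => \sum_(i < n.+1) f i * g (n - i)%N).

Fact fps_addA : associative fps_add.
Proof. by move=> f g h; apply: fpsP => n /=; rewrite addrA. Qed.
Fact fps_addC : commutative fps_add.
Proof. by move=> f g; apply: fpsP => n /=; rewrite addrC. Qed.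
Fact fps_add0 : left_id fps_zero fps_add.
Proof. by move=> f; apply: fpsP => n /=; rewrite add0r. Qed.
Fact fps_addN : left_inverse fps_zero fps_opp fps_add.
Proof. by move=> f; apply: fpsP => n /=; rewrite addNr. Qed.

HB.instance Definition _ :=
  GRing.isZmodule.Build (fps R) fps_addA fps_addC fps_add0 fps_addN.

Fact fps_mul_poly f g n m : (n < m)%N ->
  fps_mul f g n = ((\poly_(i < m) f i) * (\poly_(i < m) g i))`_n.
Proof.
move=> nm; rewrite coefM; apply: eq_bigr => i _; rewrite !coef_poly.
by rewrite (leq_ltn_trans (leq_subr _ _) nm) (leq_trans (ltn_ord i) nm).
Qed.

Fact fps_mulC : commutative fps_mul.
Proof. by move=> f g; apply: fpsP => n; rewrite !(fps_mul_poly _ _ (ltnSn n)) mulrC. Qed.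

Fact fps_mulA : associative fps_mul.
Proof.
move=> f g h; apply: fpsP => n.
pose P (u : fps R) : {poly R} := \poly_(i < n.+1) u i.
transitivity ((P f * (P g * P h))`_n).
  rewrite coefM; apply: eq_bigr => i _; rewrite coef_poly ltn_ord.
  by rewrite -(fps_mul_poly g h) // ltnS leq_subr.
rewrite mulrA coefM; apply: eq_bigr => i _; rewrite coef_poly ltnS leq_subr.
by rewrite -(fps_mul_poly f g) // ltn_ord.
Qed.

Fact fps_mul1 : left_id fps_one fps_mul.
Proof.
move=> f; apply: fpsP => n /=; rewrite big_ord_recl /= mul1r subn0.
by rewrite big1 ?addr0 // => i _; rewrite mul0r.
Qed.

Fact fps_mulDl : left_distributive fps_mul fps_add.
Proof.
move=> f g h; apply: fpsP => n /=; rewrite -big_split /=.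
by apply: eq_bigr => i _; rewrite mulrDl.
Qed.

Fact fps_one_neq0 : fps_one != 0.
Proof.
apply/eqP => /(congr1 (fun f => fcoef f 0%N)) /= /eqP.
by rewrite oner_eq0.
Qed.

HB.instance Definition _ := GRing.Zmodule_isComNzRing.Build (fps R)
  fps_mulA fps_mulC fps_mul1 fps_mulDl fps_one_neq0.

Definition fps_var : fps R := Fps (fun n => (n == 1%N)%:R).

Lemma fcoef0 n : (0 : fps R) n = 0. Proof. by []. Qed.
Lemma fcoef1 n : (1 : fps R) n = (n == 0%N)%:R. Proof. by []. Qed.
Lemma fcoefN f n : (- f) n = - f n. Proof. by []. Qed.
Lemma fcoefD f g n : (f + g) n = f n + g n. Proof. by []. Qed.
Lemma fcoefB f g n : (f - g) n = f n - g n. Proof. by []. Qed.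
Lemma fcoefM f g n : (f * g) n = \sum_(i < n.+1) f i * g (n - i)%N.
Proof. by []. Qed.
Lemma fcoefM0 f g : (f * g) 0%N = f 0%N * g 0%N.
Proof. by rewrite fcoefM big_ord1. Qed.

(* (a; x)_oo = \prod_(j >= 0) (1 - a x^j), meaningful when a and x have zero
   constant term: the factors of index j > n then do not affect the
   coefficient of degree n (see qpoch_stable). *)
Definition qpoch (a x : fps R) : fps R :=
  Fps (fun n => (\prod_(j < n.+1) (1 - a * x ^+ j)) n).

Lemma fps_mul_low f g a b n :
  (forall i, (i < a)%N -> f i = 0) -> (forall i, (i < b)%N -> g i = 0) ->
  (n < a + b)%N -> (f * g) n = 0.
Proof.
move=> fa gb nab; rewrite fcoefM big1 // => i _.
have [/fa->|ai] := ltnP i a; first by rewrite mul0r.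
have nib : (n - i < b)%N.
  by rewrite ltn_subLR ?(leq_trans nab) ?leq_add2r //; apply: (ltn_ord i).
by rewrite (gb _ nib) mulr0.
Qed.

Lemma fps_exp_low (x : fps R) j i : x 0%N = 0 -> (i < j)%N -> (x ^+ j) i = 0.
Proof.
move=> x0; elim: j i => [//|j IHj] i ij; rewrite exprS.
by apply: (@fps_mul_low _ _ 1 j) => // -[].
Qed.

Lemma qpoch_stable (a x : fps R) n N : a 0%N = 0 -> x 0%N = 0 -> (n < N)%N ->
  (\prod_(j < N) (1 - a * x ^+ j)) n = qpoch a x n.
Proof.
move=> a0 x0; elim: N => // N IHN; rewrite ltnS leq_eqVlt => /predU1P[-> //|nN].
rewrite -(IHN nN); set P := \prod_(j < N) _.
have -> : \prod_(j < N.+1) (1 - a * x ^+ j) = P - P * (a * x ^+ N).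
  by rewrite big_ord_recr /= mulrBr mulr1.
suff low : (P * (a * x ^+ N)) n = 0 by rewrite fcoefB low subr0.
apply: (@fps_mul_low _ _ 0 N) => // i iN.
apply: (@fps_mul_low _ _ 1 N) => [[]|k kN|] //; first exact: fps_exp_low.
exact: ltnW iN.
Qed.

End FpsRing.

Arguments fps_var {R}.

Section FpsUnit.
Variable R : comUnitRingType.
Implicit Types f g : fps R.

(* The first n coefficients of 1/f, from the recurrence
   f_0 g_m = [m = 0] - \sum_(i < m) f_(m-i) g_i *)
Fixpoint fps_inv_prefix f n : seq R :=
  if n is m.+1 then
    let s := fps_inv_prefix f m in
    rcons s ((f 0%N)^-1 * ((m == 0%N)%:R - \sum_(i < m) f (m - i)%N * s`_i))
  else [::].

Definition fps_unit : pred (fps R) := fun f => f 0%N \is a GRing.unit.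
Definition fps_inv f : fps R :=
  if fps_unit f then Fps (fun n => (fps_inv_prefix f n.+1)`_n) else f.

Fact size_fps_inv_prefix f n : size (fps_inv_prefix f n) = n.
Proof. by elim: n => //= n IHn; rewrite size_rcons IHn. Qed.

Fact nth_fps_inv_prefix f n m : (m < n)%N ->
  (fps_inv_prefix f n)`_m = (fps_inv_prefix f m.+1)`_m.
Proof.
elim: n => // n IHn; rewrite ltnS leq_eqVlt => /predU1P[-> //|mn].
by rewrite -IHn //= nth_rcons size_fps_inv_prefix mn.
Qed.

Fact fps_invE f n : fps_unit f -> fps_inv f n =
  (f 0%N)^-1 * ((n == 0%N)%:R - \sum_(i < n) f (n - i)%N * fps_inv f i).
Proof.
rewrite /fps_inv => -> /=; rewrite nth_rcons size_fps_inv_prefix ltnn eqxx.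
by congr (_ * (_ - _)); apply: eq_bigr => i _; rewrite nth_fps_inv_prefix.
Qed.

Fact fps_mulVf : {in fps_unit, left_inverse 1 fps_inv *%R}.
Proof.
move=> f uf; apply: fpsP => n; rewrite fcoefM fcoef1 big_ord_recr /= subnn.
rewrite (fps_invE n uf) mulrC mulVKr //.
by rewrite addrC (eq_bigr _ (fun i _ => mulrC _ _)) subrK.
Qed.

Fact fps_unitPl f g : g * f = 1 -> fps_unit f.
Proof.
move=> /(congr1 (fun u => fcoef u 0%N)); rewrite fcoefM0 => gf.
by apply/unitrPr; exists (g 0%N); rewrite mulrC.
Qed.

Fact fps_inv_out : {in [predC fps_unit], fps_inv =1 id}.
Proof. by move=> f /negbTE uf; rewrite /fps_inv ifF. Qed.

HB.instance Definition _ := GRing.ComNzRing_hasMulInverse.Build (fps R)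
  fps_mulVf fps_unitPl fps_inv_out.

End FpsUnit.

(* RGG_S x and RGG_T x are S(x) and T(x), for x with zero constant term. *)
Definition RGG_S (x : fps int) : fps int :=
  1 / (qpoch x (x ^+ 8) * qpoch (x ^+ 4) (x ^+ 8) * qpoch (x ^+ 7) (x ^+ 8)).
Definition RGG_T (x : fps int) : fps int :=
  1 / (qpoch (x ^+ 3) (x ^+ 8) * qpoch (x ^+ 4) (x ^+ 8)
       * qpoch (x ^+ 5) (x ^+ 8)).

Local Notation S := RGG_S.
Local Notation T := RGG_T.
Local Notation q := (fps_var : fps int).

Definition rho1 (k : nat) : fps int := S q ^+ k / T q ^+ k.
Definition rho2 (k : nat) : fps int := (T q * S (q ^+ k)) / (S q * T (q ^+ k)).
Definition rho3 (k : nat) : fps int := (S q * S (q ^+ k)) / (T q * T (q ^+ k)).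
Definition rho4 : fps int :=
  (T (q ^+ 2) * S (q ^+ 4)) / (S (q ^+ 2) * T (q ^+ 4)).
Definition rho5 (k : nat) : fps int :=
  (S (- q) ^+ k * T q ^+ k * S (q ^+ 4) ^+ k)
  / (S q ^+ k * T (- q) ^+ k * T (q ^+ 4) ^+ k).
Definition rho6 : fps int :=
  (S (- q) * T (q ^+ 2) * S (q ^+ 3)) / (T (- q) * S (q ^+ 2) * T (q ^+ 3)).
Definition rho7 : fps int :=
  (T (- q) * T (q ^+ 2) * S (q ^+ 3)) / (S (- q) * S (q ^+ 2) * T (q ^+ 3)).
Definition rho8 : fps int :=
  (S q * S (- q ^+ 3) * S (q ^+ 6)) / (T q * T (- q ^+ 3) * T (q ^+ 6)).
Definition rho9 : fps int :=
  (S q * T (- q ^+ 3) * S (q ^+ 6)) / (T q * S (- q ^+ 3) * T (q ^+ 6)).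

(* Main.v *)
Require Import Defs.
From Stdlib Require Import ZArith Lia.
From HB Require Import structures.
From mathcomp Require Import all_boot all_order all_algebra.
From mathcomp Require Import finmap ring zify ssrZ.
From mathcomp Require Import boolp classical_sets functions cardinality fsbigop.

(** Write G(q) = S(q)/T(q), phi(q) = sum q^(k^2), psi(q) = sum q^(2k^2+k) over
    all integers k, and f_n = f(q^n).  By the Jacobi triple product G is a
    quotient of two theta series, and rearranging rank two lattice sums gives
      2 G_1 psi_4 = phi_1 + phi_2    and    2 q G_1^-1 psi_4 = phi_1 - phi_2,
    together with G(q) G(-q) = G(q^2).  Hence every rho of the statement is a
    monomial X in the G_n, and X + q^k/X or X - q^k/X is a polynomial in theta
    series divided by a product of psi_n with 4 | n (or 8 | n).  Division by a
    series in q^m preserves residue classes of exponents mod m, so it remains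
    to see which residues occur in the numerator.  This is read off from
    phi_1 = phi_4 + 2 q psi_8, psi_1^2 = phi_1 psi_2, and from the degree 3 and
    degree 7 lattice identities for psi_1 psi_3 and psi_1 psi_7. *)

Set Implicit Arguments.
Unset Strict Implicit.
Unset Printing Implicit Defensive.

Import Order.TTheory GRing.Theory Num.Theory.
Local Open Scope ring_scope.

(** * Power series and substitution *)

(** Three points shape the details. The relation X * (1/X) = 1, and some terms of the numerators,
    leave a monomial c q^j that can lie in the residue class under study; it is carried along
    explicitly and meets no index of the statement, except at n = 0 for [rho7]. Some classes are
    taken modulo 8 while the divisors phi_4, psi_4, psi_12 are series in q^4 only. Either psi_4^2 =
    phi_4 psi_8 confines the inverse of phi_4 to other classes modulo 4, or, for [rho7] and [rho8],
    psi_4 psi_12 is multiplied by its conjugate under q^4 -> -q^4, which gives a series in q^8. The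
    quadratic identities that express phi_1^2 and phi_1 phi_7 are not obtained from a bijection of
    lattices: the defect E of each satisfies E(q) = -E(q^2), and this forces E = 0. *)

Section PowerSeries.
Variable R : comNzRingType.
Implicit Types f g h : fps R.

(** Congruence modulo q^N, the form in which limits of partial products are taken. *)
Definition fps_eq_upto (N : nat) f g := forall n, (n < N)%N -> f n = g n.

Lemma fps_eq_uptoM N f f' g g' :
  fps_eq_upto N f f' -> fps_eq_upto N g g' -> fps_eq_upto N (f * g) (f' * g').
Proof.
move=> ff' gg' n nN; rewrite !fcoefM; apply: eq_bigr => i _.
by rewrite ff' ?gg' // (leq_ltn_trans _ nN) ?leq_subr // -ltnS.
Qed.

Lemma fcoef_varM f n : (fps_var * f) n = if n is m.+1 then f m else 0.
Proof.
rewrite fcoefM big_ord_recl /= mul0r add0r; case: n => [|n]; first by rewrite big_ord0.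
rewrite big_ord_recl /= mul1r subSS subn0 big1 ?addr0 // => i _.
by rewrite mul0r.
Qed.

Lemma fcoef_varXM f k n :
  (fps_var ^+ k * f) n = if (k <= n)%N then f (n - k)%N else 0.
Proof.
elim: k n => [|k IHk] n; first by rewrite mul1r subn0.
by rewrite exprS -mulrA fcoef_varM; case: n => [//|n]; rewrite IHk.
Qed.

Lemma fcoef_varX k n : (fps_var ^+ k : fps R) n = (n == k)%:R.
Proof.
rewrite -[_ ^+ k]mulr1 fcoef_varXM fcoef1 subn_eq0.
by case: ltngtP.
Qed.

Lemma varXM_inj k : injective (fun f => fps_var ^+ k * f).
Proof.
move=> f g fg; apply: fpsP => n.
have := congr1 (fun h => fcoef h (k + n)%N) fg.
by rewrite !fcoef_varXM leq_addr addKn.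
Qed.

Lemma fcoef_natM (m : nat) f n : (m%:R * f) n = m%:R * f n.
Proof.
rewrite !mulr_natl; elim: m => [|m IHm]; first by rewrite !mulr0n.
by rewrite !mulrS fcoefD IHm.
Qed.

Lemma fcoef_signM (m : nat) f n : ((-1) ^+ m * f) n = (-1) ^+ m * f n.
Proof.
rewrite -signr_odd -[in RHS]signr_odd; case: odd; first by rewrite expr1 !mulN1r.
by rewrite !mul1r.
Qed.

Lemma fcoef_sum (I : Type) (r : seq I) (P : pred I) (F : I -> fps R) n :
  (\sum_(i <- r | P i) F i) n = \sum_(i <- r | P i) (F i) n.
Proof. by elim/big_rec2: _ => // i y1 y2 _ <-. Qed.

Lemma fps_mul_eq0r (D : idomainType) (u v : fps D) : u 0%N != 0 -> u * v = 0 -> v = 0.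
Proof.
move=> u0 uv0; apply: fpsP; elim/ltn_ind => n IHn.
have := congr1 (fun w : fps D => w n) uv0; rewrite fcoefM big_ord_recl subn0.
rewrite big1 ?addr0 => [|i _]; first by move/eqP; rewrite mulf_eq0 (negbTE u0) => /eqP.
by rewrite IHn ?mulr0 // ltn_subrL /= (leq_ltn_trans _ (ltn_ord i)).
Qed.

Lemma fps_mulI (D : idomainType) (u v w : fps D) :
  u 0%N != 0 -> u * v = u * w -> v = w.
Proof.
move=> u0 uvw; apply/eqP; rewrite -subr_eq0; apply/eqP/(fps_mul_eq0r u0).
by rewrite mulrBr uvw subrr.
Qed.

(* f(q y): the factor q makes the substituted series free of constant term. *)
Definition fps_subst (y : fps R) f : fps R :=
  Fps (fun n => \sum_(j < n.+1) f j * ((fps_var * y) ^+ j) n).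

Lemma fps_substE y f n N : (n < N)%N ->
  fps_subst y f n = \sum_(j < N) f j * ((fps_var * y) ^+ j) n.
Proof.
move=> nN; rewrite /= (big_ord_widen N (fun j => f j * ((fps_var * y) ^+ j) n)) //.
rewrite [RHS](bigID (fun j : 'I_N => j < n.+1)%N) /= [X in _ + X]big1 ?addr0 //.
by move=> j nj; rewrite fps_exp_low ?mulr0 ?fcoef_varM // ltnNge.
Qed.

Fact fps_subst_additive y : zmod_morphism (fps_subst y).
Proof.
move=> f g; apply: fpsP => n /=; rewrite -sumrB.
by apply: eq_bigr => i _; rewrite mulrBl.
Qed.

(** Both sides become double sums of f_j g_k x^(j+k), over j, k <= n on one side and over j + k <= n
    on the other. The extra terms vanish in degree n because x = q y has zero constant term. *)
Fact fps_subst_multiplicative y : monoid_morphism (fps_subst y).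
Proof.
split=> [|f g].
  apply: fpsP => n /=; rewrite big_ord_recl expr0 mul1r big1 ?addr0 //.
  by move=> i _; rewrite mul0r.
apply: fpsP => n; set x := fps_var * y.
have x0 : x 0%N = 0 by rewrite fcoef_varM.
have -> : (fps_subst y f * fps_subst y g) n
    = \sum_(j < n.+1) \sum_(k < n.+1) f j * g k * (x ^+ (j + k)) n.
  rewrite fcoefM.
  transitivity (\sum_(i < n.+1) \sum_(j < n.+1) \sum_(k < n.+1)
      f j * g k * ((x ^+ j) i * (x ^+ k) (n - i)%N)).
    apply: eq_bigr => i _.
    rewrite (@fps_substE y f i n.+1) // (@fps_substE y g _ n.+1) ?ltnS ?leq_subr //.
    rewrite big_distrlr; apply: eq_bigr => j _; apply: eq_bigr => k _.
    by rewrite mulrACA.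
  rewrite exchange_big; apply: eq_bigr => j _.
  rewrite exchange_big; apply: eq_bigr => k _.
  by rewrite exprD fcoefM mulr_sumr.
rewrite /fps_subst /= -/x.
transitivity (\sum_(m < n.+1) \sum_(j < n.+1 | (j <= m)%N)
    f j * g (m - j)%N * (x ^+ m) n).
  apply: eq_bigr => m _; rewrite mulr_suml.
  by rewrite (big_ord_widen n.+1 (fun j => f j * g (m - j)%N * (x ^+ m) n)).
rewrite (exchange_big_dep xpredT) //=; apply: eq_bigr => j _.
rewrite -(big_mkord (fun i => j <= i)%N (fun i => f j * g (i - j)%N * (x ^+ i) n)).
rewrite -(big_mkord xpredT (fun k => f j * g k * (x ^+ (j + k)) n)).
rewrite [RHS](@big_cat_nat _ _ _ (n.+1 - j)%N) ?leq_subr //=.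
rewrite [X in _ = _ + X]big_nat [X in _ = _ + X]big1 ?addr0; last first.
  move=> k /andP[jk _]; rewrite fps_exp_low ?mulr0 //.
  by rewrite -leq_subLR.
rewrite [LHS](@big_cat_nat _ _ _ j) //=; last by rewrite ltnW.
rewrite [X in X + _]big_nat_cond [X in X + _]big1 ?add0r; last first.
  by move=> i /andP[/andP[_ ij]]; rewrite leqNgt ij.
rewrite -{1}[nat_of_ord j]add0n big_addn big_mkcond; apply: eq_bigr => k _.
by rewrite leq_addl addnK addnC.
Qed.

HB.instance Definition _ y :=
  GRing.isZmodMorphism.Build (fps R) (fps R) (fps_subst y) (@fps_subst_additive y).
HB.instance Definition _ y :=
  GRing.isMonoidMorphism.Build (fps R) (fps R) (fps_subst y)
    (@fps_subst_multiplicative y).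

Lemma fps_subst0 y f : fps_subst y f 0%N = f 0%N.
Proof. by rewrite /= big_ord1 expr0 mulr1. Qed.

Lemma fps_subst_var y : fps_subst y fps_var = fps_var * y.
Proof.
apply: fpsP => n; rewrite (@fps_substE _ _ _ n.+2) // big_ord_recl mul0r add0r.
rewrite big_ord_recl expr1 mul1r big1 ?addr0 // => i _.
by rewrite mul0r.
Qed.

Lemma fps_subst_upto y N f g :
  fps_eq_upto N f g -> fps_eq_upto N (fps_subst y f) (fps_subst y g).
Proof.
move=> fg n nN /=; apply: eq_bigr => j _; rewrite fg //.
exact: leq_trans (ltn_ord j) nN.
Qed.

Lemma fps_subst_qpoch y (a x : fps R) : a 0%N = 0 -> x 0%N = 0 ->
  fps_subst y (qpoch a x) = qpoch (fps_subst y a) (fps_subst y x).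
Proof.
move=> a0 x0; apply: fpsP => n; rewrite -(@qpoch_stable _ _ _ n n.+1) ?fps_subst0 //.
rewrite (@fps_subst_upto _ n.+1 _ (\prod_(j < n.+1) (1 - a * x ^+ j))) //.
  rewrite rmorph_prod; congr (fcoef _ n); apply: eq_bigr => j _.
  by rewrite rmorphB rmorph1 rmorphM rmorphXn.
by move=> i ltin; rewrite qpoch_stable.
Qed.

End PowerSeries.

(** * Residue classes of exponents *)

Section Residues.
Variable R : comUnitRingType.
Implicit Types f g : fps R.

Definition in_powers (m : nat) : {pred fps R} :=
  fun f => `[<forall n, ~~ (m %| n)%N -> f n = 0>].

Lemma in_powersP m f :
  reflect (forall n, ~~ (m %| n)%N -> f n = 0) (f \in in_powers m).
Proof. exact: asboolP. Qed.

Fact in_powers_subring m : subring_closed (in_powers m).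
Proof.
split=> [|f g /in_powersP fm /in_powersP gm|f g /in_powersP fm /in_powersP gm];
  apply/in_powersP => n mn.
- by rewrite fcoef1; case: n mn => [|//]; rewrite dvdn0.
- by rewrite fcoefB fm ?gm ?subr0.
rewrite fcoefM big1 // => i _.
have [mi|/fm->] := boolP (m %| i)%N; last by rewrite mul0r.
rewrite gm ?mulr0 //; apply: contra mn => mni.
by rewrite -(subnKC (leq_ord i)) dvdn_add.
Qed.

HB.instance Definition _ m :=
  GRing.isSubringClosed.Build (fps R) (in_powers m) (in_powers_subring m).

(** In the recurrence for the inverse at n not divisible by m, every i < n has m not dividing i or m
    not dividing n - i. *)
Lemma in_powersV m f : f \in in_powers m -> f^-1 \in in_powers m.
Proof.
move=> fm; have [uf|/invr_out-> //] := boolP (f \is a GRing.unit).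
apply/in_powersP; elim/ltn_ind => n IHn mn.
have -> : f^-1 n = (f 0%N)^-1 * ((n == 0%N)%:R - \sum_(i < n) f (n - i)%N * f^-1 i).
  exact: fps_invE.
rewrite big1 ?subr0 => [|i _].
  by case: n mn {IHn} => [|n _]; rewrite ?dvdn0 // mulr0.
have [mi|/(IHn _ (ltn_ord i))->] := boolP (m %| i)%N; last by rewrite mulr0.
move/in_powersP: fm => ->; rewrite ?mul0r //; apply: contra mn => mni.
by rewrite -(subnKC (ltnW (ltn_ord i))) dvdn_add.
Qed.

Lemma in_powers_varX m k : (m %| k)%N -> fps_var ^+ k \in in_powers m.
Proof.
move=> mk; apply/in_powersP => n mn; rewrite fcoef_varX.
by case: eqP mn => // ->; rewrite mk.
Qed.

Lemma in_powers_subst m y f : fps_var * y \in in_powers m ->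
  fps_subst y f \in in_powers m.
Proof.
move=> ym; apply/in_powersP => n mn /=; rewrite big1 // => j _.
by have /in_powersP -> // := rpredX j ym; rewrite mulr0.
Qed.

Definition vanishes_on (m r : nat) f := forall n, n = r %[mod m] -> f n = 0.

Lemma vanishes_onD m r f g :
  vanishes_on m r f -> vanishes_on m r g -> vanishes_on m r (f + g).
Proof. by move=> fr gr n nr; rewrite fcoefD fr ?gr ?addr0. Qed.

Lemma vanishes_on_shift m r k f :
  f \in in_powers m -> k <> r %[mod m] -> vanishes_on m r (fps_var ^+ k * f).
Proof.
move=> /in_powersP fm kr n nr; rewrite fcoef_varXM; case: leqP => // kn.
rewrite fm //; apply/negP; rewrite -eqn_mod_dvd // => /eqP nk.
by apply: kr; rewrite -nk.
Qed.

Lemma vanishes_onM m r f g :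
  f \in in_powers m -> vanishes_on m r g -> vanishes_on m r (f * g).
Proof.
move=> /in_powersP fm gr n nr; rewrite fcoefM big1 // => i _.
have [mi|/fm->] := boolP (m %| i)%N; last by rewrite mul0r.
rewrite gr ?mulr0 // -nr; apply/esym/eqP.
by rewrite eqn_mod_dvd ?leq_subr // subKn ?leq_ord.
Qed.

End Residues.

(* Divisors supported on multiples of m preserve the residue classes mod m. *)
Lemma vanishes_on_div m r (c k : nat) (M F : fps int) :
  M \in in_powers m -> M 0%N = 1 -> (0 < c)%N ->
  vanishes_on m (r + k) (c%:R * fps_var ^+ k * M * F) -> vanishes_on m r F.
Proof.
move=> Mm M0 c0 van.
have uM : M \is a GRing.unit by rewrite unfold_in /= /fps_unit M0.
suff : vanishes_on m r (M * F).
  by move/(vanishes_onM (in_powersV Mm)); rewrite mulKr.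
move=> n nr; have /van : (n + k = r + k %[mod m])%N by rewrite -modnDml nr modnDml.
rewrite -!mulrA fcoef_natM fcoef_varXM leq_addl addnK => /eqP.
by rewrite mulf_eq0 pnatr_eq0 (gtn_eqF c0) => /eqP.
Qed.

(** * Lattice sums *)

Section LatticeSum.
Local Open Scope classical_set_scope.
Implicit Types I J : choiceType.

(* The coefficients are junk (zero) on infinite fibres of e; see finite_fibers. *)
Definition lattice_sum I (e : I -> nat) (c : I -> int) : fps int :=
  Fps (fun n => \sum_(i \in [set i | e i = n]) c i).

Definition finite_fibers I (e : I -> nat) := forall n, finite_set [set i | e i = n].

Lemma lattice_sum_reindex I J (h : J -> I) (g : I -> J)
    (e : I -> nat) (c : I -> int) (e' : J -> nat) (c' : J -> int) :
  cancel h g -> cancel g h -> (forall j, e (h j) = e' j) ->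
  (forall j, c (h j) = c' j) -> lattice_sum e c = lattice_sum e' c'.
Proof.
move=> hK gK he hc; apply: fpsP => n /=.
rewrite (@reindex_fsbig _ _ _ _ _ h [set j | e' j = n]).
  by apply: eq_fsbigr => j _; rewrite hc.
split=> [j /= <-|j k _ _ /(can_inj hK)//|i /= ei]; first by rewrite he.
by exists (g i) => //=; rewrite -he gK.
Qed.

Lemma lattice_sumD I J (e : I -> nat) (c : I -> int) (e' : J -> nat) (c' : J -> int) :
  finite_fibers e -> finite_fibers e' ->
  lattice_sum e c + lattice_sum e' c'
    = lattice_sum (fun s : I + J => match s with inl i => e i | inr j => e' j end)
                  (fun s : I + J => match s with inl i => c i | inr j => c' j end).
Proof.
move=> fe fe'; apply: fpsP => n /=; set F := (X in _ = \sum_(s \in _) X s).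
have -> : [set s : I + J | match s with inl i => e i | inr j => e' j end = n]
    = (inl @` [set i | e i = n]) `|` (inr @` [set j | e' j = n]).
  apply/seteqP; split=> [[i|j] /= H|[i|j] /=].
  - by left; exists i.
  - by right; exists j.
  - by case=> [[? ? [<-]]|[]].
  - by case=> [[]|[? ? [<-]]] .
rewrite fsbigU0 ?fsbig_image //.
- by move=> j k _ _ [].
- by move=> j k _ _ [].
- exact: finite_image.
- exact: finite_image.
- by move=> s [[i _ <-] []].
Qed.

Lemma lattice_sum_shift I k (e : I -> nat) (c : I -> int) :
  fps_var ^+ k * lattice_sum e c = lattice_sum (fun i => k + e i)%N c.
Proof.
apply: fpsP => n; rewrite fcoef_varXM /=; case: leqP => kn.
  apply: eq_fsbigl; apply/seteqP; split=> i /= H; first by rewrite H subnKC.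
  by rewrite -H addKn.
rewrite fsbig1 // => i /= H; move: kn.
by rewrite -H ltnNge leq_addr.
Qed.

Lemma lattice_sumN I (e : I -> nat) (c : I -> int) :
  - lattice_sum e c = lattice_sum e (fun i => - c i).
Proof.
apply: fpsP => n /=; rewrite -mulN1r mulr_fsumr.
by apply: eq_fsbigr => i _; rewrite mulN1r.
Qed.

Lemma finite_fibersD I J (e : I -> nat) (e' : J -> nat) :
  finite_fibers e -> finite_fibers e' ->
  finite_fibers (fun p : I * J => e p.1 + e' p.2)%N.
Proof.
move=> fe fe' n.
apply: (@sub_finite_set _ _
  (\bigcup_(i in `I_n.+1) ([set i' | e i' = i] `*` [set j | e' j = n - i]%N))).
  move=> [i j] /= H; exists (e i) => /=; first by rewrite ltnS -H leq_addr.
  by split=> //=; rewrite -H addKn.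
by apply: bigcup_finite => // i _; apply: finite_setX.
Qed.

(** The fibre over n is partitioned by the exponent of the first component; this exponent is at most
    n there, so the default value of [inord] never enters. *)
Lemma lattice_sumM I J (e : I -> nat) (c : I -> int) (e' : J -> nat) (c' : J -> int) :
  finite_fibers e -> finite_fibers e' ->
  lattice_sum e c * lattice_sum e' c'
    = lattice_sum (fun p : I * J => e p.1 + e' p.2)%N (fun p => c p.1 * c' p.2).
Proof.
move=> fe fe'; apply: fpsP => n; rewrite fcoefM.
rewrite [RHS](fsbig_finite _ _ (finite_fibersD fe fe' n)).
rewrite (partition_big (fun p : I * J => inord (e p.1) : 'I_n.+1) xpredT) //=.
apply: eq_bigr => i _; rewrite mulr_fsuml.
under eq_fsbigr do rewrite mulr_fsumr.
rewrite pair_fsbig // fsbig_finite; last exact: finite_setX.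
rewrite -[RHS]big_filter; apply: perm_big; apply: uniq_perm.
- exact: fset_uniq.
- by apply: filter_uniq; exact: fset_uniq.
move=> [x y]; rewrite mem_filter in_fset_set; last exact: finite_setX.
rewrite in_fset_set; last exact: finite_fibersD.
apply/idP/idP; rewrite !inE /=.
  case=> ex ey; rewrite ex inord_val eqxx /= inE /= ex ey.
  by rewrite subnKC // leq_ord.
case/andP => /eqP <-; rewrite inE /= => <-.
by rewrite inordK ?addKn // ltnS leq_addr.
Qed.

End LatticeSum.

Notation q := (fps_var : fps int).

(** * Theta series and their lattice identities *)

Delimit Scope Z_scope with BZ.

Notation sgn k := (if Z.even k then 1 else -1 : int).

HB.lock Definition phi (d : nat) : fps int :=
  lattice_sum (fun k : Z => d * Z.to_nat (k * k))%N (fun _ => 1).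
HB.lock Definition phim (d : nat) : fps int :=
  lattice_sum (fun k : Z => d * Z.to_nat (k * k))%N (fun k => sgn k).
(* Over all integers k, the exponents 2k^2+k run once through the triangular
   numbers. *)
HB.lock Definition psi (d : nat) : fps int :=
  lattice_sum (fun k : Z => d * Z.to_nat (2 * (k * k) + k))%N (fun _ => 1).
HB.lock Definition psim (d : nat) : fps int :=
  lattice_sum (fun k : Z => d * Z.to_nat (2 * (k * k) + k))%N (fun k => sgn k).
(** Ramanujan's f(-q^(4+r), -q^(4-r)); r = 1 and r = 3 give the numerator and the denominator of
    G. *)
HB.lock Definition theta4 (r : nat) : fps int :=
  lattice_sum (fun k : Z => Z.to_nat (4 * (k * k) + Z.of_nat r * k)) (fun k => sgn k).

Definition thetaE := (phi.unlock, phim.unlock, psi.unlock, psim.unlock, theta4.unlock).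

Lemma finite_fibers_Z (e : Z -> nat) :
  (forall k, (Z.abs_nat k <= e k)%N) -> finite_fibers e.
Proof.
move=> le_e n.
apply: (@sub_finite_set _ _
  ((fun i => Z.of_nat i - Z.of_nat n)%BZ @` `I_(n + n).+1)%classic).
  move=> k /= ek; have := le_e k => kn.
  by exists (Z.to_nat (k + Z.of_nat n)) => /=; lia.
by apply: finite_image; apply: finite_II.
Qed.

Lemma finite_fibers_phi d : (0 < d)%N ->
  finite_fibers (fun k : Z => d * Z.to_nat (k * k))%N.
Proof.
move=> d0; apply: finite_fibers_Z => k; apply: leq_trans (leq_pmull _ d0).
by have : (Z.abs k <= k * k)%BZ; nia.
Qed.

Lemma finite_fibers_psi d : (0 < d)%N ->
  finite_fibers (fun k : Z => d * Z.to_nat (2 * (k * k) + k))%N.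
Proof.
move=> d0; apply: finite_fibers_Z => k; apply: leq_trans (leq_pmull _ d0).
by have : (Z.abs k <= 2 * (k * k) + k)%BZ; nia.
Qed.

Lemma finite_fibers_theta4 r : (r < 4)%N ->
  finite_fibers (fun k : Z => Z.to_nat (4 * (k * k) + Z.of_nat r * k)).
Proof.
move=> r4; apply: finite_fibers_Z => k.
have : (Z.abs k <= k * k)%BZ by nia.
by case: r r4 => [|[|[|[]]]] // _; lia.
Qed.

Lemma finite_fibers_shift (I : choiceType) k (e : I -> nat) :
  finite_fibers e -> finite_fibers (fun i => k + e i)%N.
Proof.
by move=> fe n; apply: sub_finite_set (fe (n - k)%N) => i /= <-; rewrite addKn.
Qed.

Lemma finite_fibers_sum (I J : choiceType) (e : I -> nat) (e' : J -> nat) :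
  finite_fibers e -> finite_fibers e' ->
  finite_fibers (fun s : I + J => match s with inl i => e i | inr j => e' j end).
Proof.
move=> fe fe' n.
apply: (@sub_finite_set _ _ ((inl @` [set i | e i = n]) `|`
  (inr @` [set j | e' j = n]))%classic).
  by move=> [i|j] /= H; [left; exists i | right; exists j].
by rewrite finite_setU; split; apply: finite_image.
Qed.

Ltac fibers := repeat first
  [ exact: finite_fibers_phi | exact: finite_fibers_psi
  | exact: finite_fibers_theta4
  | exact: (finite_fibersD (@finite_fibers_theta4 _ _) (@finite_fibers_theta4 _ _))
  | exact: (finite_fibersD (@finite_fibers_phi _ _) (@finite_fibers_psi _ _))
  | exact: (finite_fibersD (@finite_fibers_psi _ _) (@finite_fibers_psi _ _))
  | apply: finite_fibers_shift | apply: finite_fibers_sum ].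

Lemma Zsqr_ge0 k : (0 <= k * k)%BZ. Proof. nia. Qed.
Lemma psi_exp_ge0 k : (0 <= 2 * (k * k) + k)%BZ. Proof. nia. Qed.
Lemma theta4_exp_ge0 k : (0 <= 4 * (k * k) + 3 * k)%BZ.
Proof. have : (0 <= k * (k + 1))%BZ by nia. nia. Qed.
Arguments theta4_exp_ge0 : clear implicits.
Arguments Zsqr_ge0 : clear implicits.
Arguments psi_exp_ge0 : clear implicits.

Ltac retype_Z := lazy beta iota delta [fst snd]; repeat match goal with k : Choice.sort _ |- _ => change Z in k end.

(** Settles the inverse conditions of piecewise affine bijections: impossible combinations of
    residue tests are refuted, the remaining coordinates compared by Euclidean division. *)
Ltac piecewise := retype_Z; lazy beta iota;
  repeat case: Z.eqb_spec => ?; try (exfalso; Z.to_euclidean_division_equations; lia);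
  repeat match goal with
  | |- @eq _ (inl _) (inl _) => apply: (f_equal inl)
  | |- @eq _ (inr _) (inr _) => apply: (f_equal inr)
  | |- @eq _ (_, _) (_, _) => apply: (f_equal2 pair)
  end;
  match goal with |- @eq _ ?a ?b => change (@eq Z a b); Z.to_euclidean_division_equations; lia end.

(** Even k give [phi 4]. Every odd integer is 4k+1 or -(4k+1) for exactly one k, and (4k+1)^2 =
    8(2k^2+k)+1, so [q * psi 8] occurs twice. *)
Lemma phi_split4 : phi 1 = phi 4 + q * psi 8 + q * psi 8.
Proof.
rewrite !thetaE -[q]expr1 !lattice_sum_shift !lattice_sumD; [|by fibers..].
apply: (@lattice_sum_reindex _ _
  (fun s : Z + Z + Z => match s with inl (inl k) => 2 * k | inl (inr k) => 4 * k + 1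
     | inr k => - (4 * k + 1) end)%BZ
  (fun n => if (n mod 2 =? 0) then inl (inl (n / 2)) else
     if (n mod 4 =? 1) then inl (inr (n / 4)) else inr ((- n) / 4))%BZ).
- by case=> [[k|k]|k]; piecewise.
- by move=> n; piecewise.
- by case=> [[k|k]|k]; have := Zsqr_ge0 k; have := psi_exp_ge0 k; retype_Z; retype_Z; lia.
- by case=> [[k|k]|k].
Qed.

(** Both sides are brought to one sum over P: the left by the parity of m + n, passing to half sum
    and half difference, the right by the parity of the index of [phi 1]. *)
Lemma psi_sqr : psi 1 ^+ 2 = phi 1 * psi 2.
Proof.
rewrite !thetaE expr2 !lattice_sumM; [|by fibers..].
pose P : Type := (Z * Z + Z * Z)%type.
transitivity (lattice_sum (fun x : P => match x with
    | inl (s, t) => Z.to_nat (4 * (s * s) + 2 * s + 4 * (t * t))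
    | inr (s, t) => Z.to_nat (4 * (s * s) + 6 * s + 4 * (t * t) + 4 * t + 3)
    end)%BZ (fun _ => 1)).
  apply: (@lattice_sum_reindex _ _
    (fun x : P => match x with inl (s, t) => (s + t, s - t)
       | inr (s, t) => (s + t + 1, s - t) end)%BZ
    (fun p => let '(m, n) := p in
       if (m + n) mod 2 =? 0 then inl ((m + n) / 2, (m - n) / 2)
       else inr ((m + n) / 2, (m - n) / 2))%BZ).
  - by case=> [] [s t]; piecewise.
  - by move=> [m n]; piecewise.
  - by case=> [] [s t]; have := psi_exp_ge0 (s + t);
      have := psi_exp_ge0 (s - t); have := psi_exp_ge0 (s + t + 1); retype_Z; lia.
  - by case=> [] [].
symmetry.
apply: (@lattice_sum_reindex _ _
  (fun x : P => match x with inl (s, t) => (2 * t, s)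
     | inr (s, t) => (2 * t + 1, - (s + 1)) end)%BZ
  (fun p => let '(j, k) := p in
     if j mod 2 =? 0 then inl (k, j / 2) else inr (- (k + 1), j / 2))%BZ).
- by case=> [] [s t]; piecewise.
- by move=> [m n]; piecewise.
- by case=> [] [s t]; have := Zsqr_ge0 (2 * t); have := Zsqr_ge0 (2 * t + 1);
    have := psi_exp_ge0 s; have := psi_exp_ge0 (- (s + 1)); retype_Z; lia.
- by case=> [] [].
Qed.

Section LatticeIdentities.
Local Open Scope Z_scope.

(** The image of (m, n) -> (m - n, m + n) has index 2. The second summand covers the pairs with j +
    k odd; there the reflection to k = -(m + n + 1) yields the exponent 4m^2 + 3m + 4n^2 + 3n +
    1. *)
Definition rot_pair (x : Z * Z + Z * Z) : Z * Z :=
  match x with inl (m, n) => (m - n, m + n) | inr (m, n) => (m - n, - (m + n + 1)) end.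
Definition unrot_pair (p : Z * Z) : Z * Z + Z * Z :=
  let '(j, k) := p in
  if (j + k) mod 2 =? 0 then inl ((k + j) / 2, (k - j) / 2)
  else inr ((- k - 1 + j) / 2, (- k - 1 - j) / 2).

Lemma rot_pairK : cancel rot_pair unrot_pair.
Proof. by rewrite /rot_pair /unrot_pair; case=> [] [m n]; piecewise. Qed.

Lemma unrot_pairK : cancel unrot_pair rot_pair.
Proof. by rewrite /rot_pair /unrot_pair => - [j k]; piecewise. Qed.

Lemma rot_pair_exp (x : Z * Z + Z * Z) :
  (2 * Z.to_nat ((rot_pair x).1 * (rot_pair x).1)
    + 1 * Z.to_nat (2 * ((rot_pair x).2 * (rot_pair x).2) + (rot_pair x).2))%N
  = match x with
    | inl (m, n) => (Z.to_nat (4 * (m * m) + Z.of_nat 1 * m)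
                     + Z.to_nat (4 * (n * n) + Z.of_nat 1 * n))%N
    | inr (m, n) => (1 + (Z.to_nat (4 * (m * m) + Z.of_nat 3 * m)
                     + Z.to_nat (4 * (n * n) + Z.of_nat 3 * n)))%N
    end.
Proof.
case: x => [] [m n]; rewrite /rot_pair.
- by have := Zsqr_ge0 (m - n); have := psi_exp_ge0 (m + n); have := Zsqr_ge0 m;
    have := Zsqr_ge0 n; have := psi_exp_ge0 m; have := psi_exp_ge0 n; retype_Z; lia.
have := theta4_exp_ge0 m; have := theta4_exp_ge0 n.
by have := Zsqr_ge0 (m - n); have := psi_exp_ge0 (- (m + n + 1)); retype_Z; lia.
Qed.

(** The sign (-1)^j of the [phim] factor is (-1)^(m+n) on both summands of [rot_pair]; in
    [theta4_sqrB] the sign (-1)^k is opposite on the second one, whence the minus. *)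
Lemma theta4_sqrD :
  (theta4 1 ^+ 2 + q * theta4 3 ^+ 2 = phim 2 * psi 1)%R.
Proof.
rewrite !thetaE !expr2 -{1}[q]expr1 !lattice_sumM; [|by fibers..].
rewrite lattice_sum_shift lattice_sumD; [|by fibers..]; symmetry.
apply: (lattice_sum_reindex rot_pairK unrot_pairK) => x.
  by rewrite rot_pair_exp; case: x => [] [].
by case: x => [] [m n] /=; rewrite Z.even_sub; do 2 case: Z.even.
Qed.

Lemma theta4_sqrB :
  (theta4 1 ^+ 2 - q * theta4 3 ^+ 2 = phi 2 * psim 1)%R.
Proof.
rewrite !thetaE !expr2 -{1}[q]expr1 !lattice_sumM; [|by fibers..].
rewrite lattice_sum_shift lattice_sumN lattice_sumD; [|by fibers..]; symmetry.
apply: (lattice_sum_reindex rot_pairK unrot_pairK) => x.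
  by rewrite rot_pair_exp; case: x => [] [].
by case: x => [] [m n] /=; rewrite ?Z.even_opp !Z.even_add; do 2 case: Z.even.
Qed.

(* With u = 4m+1 and v = 4n+1 the exponents on the left are (u^2+3v^2-4)/8, and
   the pieces come from u+v sqrt(-3) multiplied by (1-sqrt(-3))/2. *)
Lemma psi_psi3 : (psi 1 * psi 3 = phi 6 * psi 4 + q * (phi 2 * psi 12))%R.
Proof.
rewrite !thetaE -[q]expr1 !lattice_sumM; [|by fibers..].
rewrite lattice_sum_shift lattice_sumD; [|by fibers..].
(* The four components are the residues 0, 2, 1, 3 of n - m modulo 4 on the left; on the right each
   product splits by the parity of the [phi] index. *)
pose P : Type := (Z * Z + Z * Z + (Z * Z + Z * Z))%type.
transitivity (lattice_sum (fun x : P => match x with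
    | inl (inl (t, l)) => Z.to_nat (24 * (t * t) + 8 * (l * l) + 4 * l)
    | inl (inr (t, l)) => Z.to_nat (24 * (t * t) + 24 * t + 6 + 8 * (l * l) + 4 * l)
    | inr (inl (t, l)) => Z.to_nat (1 + 8 * (t * t) + 24 * (l * l) + 12 * l)
    | inr (inr (t, l)) => Z.to_nat (3 + 8 * (t * t) + 8 * t + 24 * (l * l) + 12 * l)
    end) (fun _ => 1%R)).
  apply: (@lattice_sum_reindex _ _
    (fun x : P => match x with
       | inl (inl (t, l)) => (l - 3 * t, l + t)
       | inl (inr (t, l)) => (- 3 * t - l - 2, t - l)
       | inr (inl (t, l)) => (t - 3 * l - 1, t + l)
       | inr (inr (t, l)) => (t + 3 * l + 1, t - l)
       end)
    (fun p => let '(m, n) := p in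
       if (n - m) mod 4 =? 0 then inl (inl ((n - m) / 4, n - (n - m) / 4))
       else if (n - m) mod 4 =? 2 then inl (inr ((n - m) / 4, (n - m) / 4 - n))
       else if (n - m) mod 4 =? 1 then inr (inl (n - (n - m) / 4, (n - m) / 4))
       else inr (inr (n + (m - n - 1) / 4, (m - n - 1) / 4)))).
  - by case=> [[] [t l]|[] [t l]]; piecewise.
  - by move=> [m n]; piecewise.
  - case=> [[] [t l]|[] [t l]]; retype_Z.
    + by have := psi_exp_ge0 (l - 3 * t); have := psi_exp_ge0 (l + t); lia.
    + by have := psi_exp_ge0 (- 3 * t - l - 2); have := psi_exp_ge0 (t - l); lia.
    + by have := psi_exp_ge0 (t - 3 * l - 1); have := psi_exp_ge0 (t + l); lia.
    + by have := psi_exp_ge0 (t + 3 * l + 1); have := psi_exp_ge0 (t - l); lia.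
  - by case=> [[] []|[] []].
symmetry; apply: (@lattice_sum_reindex _ _
  (fun x : P => match x with
     | inl (inl (t, l)) => inl (2 * t, l)
     | inl (inr (t, l)) => inl (2 * t + 1, l)
     | inr (inl (t, l)) => inr (2 * t, l)
     | inr (inr (t, l)) => inr (2 * t + 1, l)
     end)
  (fun s : Z * Z + Z * Z => match s with
     | inl (k, l) => if k mod 2 =? 0 then inl (inl (k / 2, l)) else inl (inr (k / 2, l))
     | inr (k, l) => if k mod 2 =? 0 then inr (inl (k / 2, l)) else inr (inr (k / 2, l))
     end)).
- by case=> [[] [t l]|[] [t l]]; piecewise.
- by move=> [] [k l]; piecewise.
- by case=> [[] [t l]|[] [t l]]; have := psi_exp_ge0 l; have := Zsqr_ge0 (2 * t);
    have := Zsqr_ge0 (2 * t + 1); retype_Z; lia.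
- by case=> [[] []|[] []].
Qed.

(* Same as psi_psi3, in the norm form u^2+7v^2: multiply u+v sqrt(-7) by
   (1-sqrt(-7))/4. *)
Lemma psi_psi7 :
  (psi 1 * psi 7
    = phi 28 * psi 8 + q * (psi 14 * psi 2) + q ^+ 6 * (phi 4 * psi 56))%R.
Proof.
rewrite !thetaE -{1}[q]expr1 !lattice_sumM; [|by fibers..].
rewrite !lattice_sum_shift !lattice_sumD; [|by fibers..].
(* On the left n - m is 0 or 4 modulo 8, then 1 or 3 modulo 4, then 2 or 6 modulo 8. Odd n - m gives
   the product of two [psi], whose exponent keeps a cross term in t k. *)
pose P : Type := (Z * Z + Z * Z + (Z * Z + Z * Z) + (Z * Z + Z * Z))%type.
transitivity (lattice_sum (fun x : P => match x with
    | inl (inl (inl (t, l))) => Z.to_nat (112 * (t * t) + 16 * (l * l) + 8 * l)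
    | inl (inl (inr (t, l))) =>
        Z.to_nat (28 + 112 * (t * t) + 112 * t + 16 * (l * l) + 8 * l)
    | inl (inr (inl (t, k))) =>
        Z.to_nat (1 + 32 * (k * k) + 12 * k + 16 * (t * t) + 4 * t - 16 * (t * k))
    | inl (inr (inr (t, k))) =>
        Z.to_nat (3 + 32 * (k * k) + 20 * k + 16 * (t * t) + 12 * t + 16 * (t * k))
    | inr (inl (t, l)) => Z.to_nat (6 + 16 * (t * t) + 112 * (l * l) + 56 * l)
    | inr (inr (t, l)) => Z.to_nat (10 + 16 * (t * t) + 16 * t + 112 * (l * l) + 56 * l)
    end) (fun _ => 1%R)).
  apply: (@lattice_sum_reindex _ _
    (fun x : P => match x with
       | inl (inl (inl (t, l))) => (l - 7 * t, l + t)
       | inl (inl (inr (t, l))) => (- 7 * t - l - 4, t - l)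
       | inl (inr (inl (t, k))) => (t - 4 * k - 1, t)
       | inl (inr (inr (t, k))) => (t + 4 * k + 1, t)
       | inr (inl (t, l)) => (t - 7 * l - 2, t + l)
       | inr (inr (t, l)) => (t + 7 * l + 2, t - l)
       end)
    (fun p => let '(m, n) := p in
       if (n - m) mod 8 =? 0 then inl (inl (inl ((n - m) / 8, n - (n - m) / 8)))
       else if (n - m) mod 8 =? 4 then inl (inl (inr ((n - m) / 8, (n - m) / 8 - n)))
       else if (n - m) mod 8 =? 2 then inr (inl (n - (n - m) / 8, (n - m) / 8))
       else if (n - m) mod 8 =? 6 then inr (inr (n + (m - n) / 8, (m - n) / 8))
       else if (n - m) mod 4 =? 1 then inl (inr (inl (n, (n - m) / 4)))
       else inl (inr (inr (n, (m - n) / 4))))).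
  - by case=> [[[] [t l]|[] [t l]]|[] [t l]]; piecewise.
  - by move=> [m n]; piecewise.
  - case=> [[[] [t l]|[] [t l]]|[] [t l]]; retype_Z.
    + by have := psi_exp_ge0 (l - 7 * t); have := psi_exp_ge0 (l + t); lia.
    + by have := psi_exp_ge0 (- 7 * t - l - 4); have := psi_exp_ge0 (t - l); lia.
    + by have := psi_exp_ge0 (t - 4 * l - 1); have := psi_exp_ge0 t; lia.
    + by have := psi_exp_ge0 (t + 4 * l + 1); have := psi_exp_ge0 t; lia.
    + by have := psi_exp_ge0 (t - 7 * l - 2); have := psi_exp_ge0 (t + l); lia.
    + by have := psi_exp_ge0 (t + 7 * l + 2); have := psi_exp_ge0 (t - l); lia.
  - by case=> [[[] []|[] []]|[] []].
symmetry; apply: (@lattice_sum_reindex _ _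
  (fun x : P => match x with
     | inl (inl (inl (t, l))) => inl (inl (2 * t, l))
     | inl (inl (inr (t, l))) => inl (inl (2 * t + 1, l))
     | inl (inr (inl (t, k))) => inl (inr (k, 2 * t - k))
     | inl (inr (inr (t, k))) => inl (inr (k, - 2 * t - 1 - k))
     | inr (inl (t, l)) => inr (2 * t, l)
     | inr (inr (t, l)) => inr (2 * t + 1, l)
     end)
  (fun s : Z * Z + Z * Z + Z * Z => match s with
     | inl (inl (k, l)) =>
         if k mod 2 =? 0 then inl (inl (inl (k / 2, l))) else inl (inl (inr (k / 2, l)))
     | inl (inr (k, l)) =>
         if (k + l) mod 2 =? 0 then inl (inr (inl ((k + l) / 2, k)))
         else inl (inr (inr ((- 1 - k - l) / 2, k)))
     | inr (k, l) => if k mod 2 =? 0 then inr (inl (k / 2, l)) else inr (inr (k / 2, l))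
     end)).
- by case=> [[[] [t l]|[] [t l]]|[] [t l]]; piecewise.
- by move=> [[] [k l]|[k l]]; piecewise.
- case=> [[[] [t l]|[] [t l]]|[] [t l]]; retype_Z.
  + by have := psi_exp_ge0 l; have := Zsqr_ge0 (2 * t); lia.
  + by have := psi_exp_ge0 l; have := Zsqr_ge0 (2 * t + 1); lia.
  + by have := psi_exp_ge0 l; have := psi_exp_ge0 (2 * t - l); lia.
  + by have := psi_exp_ge0 l; have := psi_exp_ge0 (- 2 * t - 1 - l); lia.
  + by have := psi_exp_ge0 l; have := Zsqr_ge0 (2 * t); lia.
  + by have := psi_exp_ge0 l; have := Zsqr_ge0 (2 * t + 1); lia.
- by case=> [[[] []|[] []]|[] []].
Qed.

End LatticeIdentities.

(** * The Jacobi triple product *)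

Section GaussianBinomial.
Variable R : comNzRingType.
Implicit Types p A B : R.

Fixpoint gbin p (n k : nat) : R :=
  match n, k with
  | _, 0%N => 1
  | 0%N, _.+1 => 0
  | n'.+1, k'.+1 => gbin p n' k + p ^+ (n' - k') * gbin p n' k'
  end.

Lemma gbin_small p n k : (n < k)%N -> gbin p n k = 0.
Proof.
elim: n k => [|n IHn] [|k] //= nk.
by rewrite !IHn ?mulr0 ?addr0 // ltnW.
Qed.

Lemma gbin0 p n : gbin p n 0 = 1. Proof. by case: n. Qed.

(** The homogeneous form, with A free, permits A = q^(8N) below, which centres the product without
    negative powers of q. *)
Lemma qbinomial p A B n :
  \prod_(j < n) (A + B * p ^+ j)
    = \sum_(i < n.+1) gbin p n i * p ^+ 'C(i, 2) * A ^+ (n - i) * B ^+ i.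
Proof.
elim: n => [|n IHn]; first by rewrite big_ord0 big_ord1 /= !mul1r.
rewrite big_ord_recr IHn /= mulrDr [RHS]big_ord_recl.
under [X in _ = _ + X]eq_bigr => i _ do rewrite /= /bump add1n subSS !mulrDl.
rewrite big_split addrA; congr (_ + _).
  rewrite big_ord_recl mulrDl gbin0 !mul1r !subn0 !expr0 !mulr1 /= exprSr.
  congr (_ + _); rewrite [RHS]big_ord_recr /= gbin_small // !mul0r addr0.
  rewrite mulr_suml; apply: eq_bigr => i _; rewrite /bump add1n.
  have -> : (n - i = (n - i.+1).+1)%N by have := ltn_ord i; lia.
  by rewrite [A ^+ _.+1]exprSr; ring.
rewrite mulr_suml; apply: eq_bigr => i _.
rewrite !add0n binS bin1 exprS [_ ^+ ('C(_, _) + _)]exprD.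
have -> : p ^+ n = p ^+ (n - i) * p ^+ i.
  by rewrite -exprD subnK // -ltnS.
by ring.
Qed.

Lemma gbinnn p n : gbin p n n = 1.
Proof. by elim: n => //= n ->; rewrite gbin_small // subnn mulr1 add0r. Qed.

Definition pfact p n : R := \prod_(j < n) (1 - p * p ^+ j).

Lemma pfactS p n : pfact p n.+1 = pfact p n * (1 - p ^+ n.+1).
Proof. by rewrite /pfact big_ord_recr exprS. Qed.

(** Induction on i + j through Pascal's rule, with 1 - p^(i+j) split as (1 - p^j) + p^j (1 -
    p^i). *)
Lemma gbin_pfact p i j : gbin p (i + j) i * pfact p i * pfact p j = pfact p (i + j).
Proof.
have pfact0 : pfact p 0 = 1 by rewrite /pfact big_ord0.
have [m] := ubnP (i + j)%N; elim: m i j => // m IHm [|i] j.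
  by rewrite gbin0 add0n mul1r pfact0 mul1r.
case: j => [|j] ltm; first by rewrite addn0 gbinnn pfact0 mul1r mulr1.
have e1 : gbin p (i + j).+1 i.+1 * pfact p i.+1 * pfact p j = pfact p (i + j).+1.
  by rewrite -addSn; apply: IHm; lia.
have e2 : gbin p (i + j).+1 i * pfact p i * pfact p j.+1 = pfact p (i + j).+1.
  by rewrite -addnS; apply: IHm; lia.
rewrite addSn addnS [gbin _ _ _]/= -/(gbin p (i + j).+1 i.+1) -/(gbin p (i + j).+1 i).
have -> : ((i + j).+1 - i = j.+1)%N by lia.
rewrite (pfactS p (i + j).+1).
have -> : p ^+ (i + j).+2 = p ^+ i.+1 * p ^+ j.+1 by rewrite -exprD; congr (_ ^+ _); lia.
transitivity (pfact p (i + j).+1 * (1 - p ^+ j.+1)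
  + p ^+ j.+1 * (1 - p ^+ i.+1) * pfact p (i + j).+1); last by ring.
by rewrite -{1}e1 -e2 !pfactS; ring.
Qed.
End GaussianBinomial.

Lemma bin2_double i : ('C(i, 2) * 2 + i = i * i)%N.
Proof. by elim: i => // i IHi; rewrite binS bin1; lia. Qed.

Lemma even_of_nat n : Z.even (Z.of_nat n) = ~~ odd n.
Proof.
by elim: n => // n IHn; rewrite Nat2Z.inj_succ Z.even_succ -Z.negb_even IHn negbK.
Qed.

Section TripleProduct.
Variables (r : nat) (r4 : (r < 4)%N).

Let e (k : Z) := Z.to_nat (4 * (k * k) + Z.of_nat r * k).
Let k_of (N i : nat) : Z := (Z.of_nat i - Z.of_nat N)%BZ.

Let finite_prod N : fps int :=
  (\prod_(j < N) (1 - q ^+ (4 + r) * (q ^+ 8) ^+ j))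
  * (\prod_(j < N) (1 - q ^+ (4 - r) * (q ^+ 8) ^+ j)).

(** After multiplication by q^E, with E the first three terms, each exponent of the symmetric sum
    over k = i - N becomes the one delivered by [qbinomial]. *)
Lemma theta4_exp_shift N i : (i <= N + N)%N ->
  ((4 + r) * N + 8 * 'C(N, 2) + 8 * N * N + e (k_of N i)
    = 8 * 'C(i, 2) + 8 * N * (N + N - i) + (4 + r) * i)%N.
Proof.
move=> iN; have := bin2_double i; have := bin2_double N.
have : (0 <= 4 * (k_of N i * k_of N i) + Z.of_nat r * k_of N i)%BZ.
  by have : (Z.abs (k_of N i) <= k_of N i * k_of N i)%BZ; nia.
rewrite /e /k_of; nia.
Qed.

(** [qbinomial] with 2N factors and A = q^(8N): the factors with j >= N give the product with 4 + r;
    those with j < N, read backwards with a sign and a power of q taken out, give the product with 4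
    - r. *)
Lemma finite_triple_product N :
  finite_prod N = \sum_(i < (N + N).+1)
    (-1) ^+ (i + N) * gbin (q ^+ 8) (N + N) i * q ^+ e (k_of N i).
Proof.
pose E := ((4 + r) * N + 8 * 'C(N, 2) + 8 * N * N)%N.
have := qbinomial (q ^+ 8) (q ^+ (8 * N)) (- q ^+ (4 + r)) (N + N).
rewrite big_split_ord /=.
have -> : \prod_(i < N) (q ^+ (8 * N) + - q ^+ (4 + r) * (q ^+ 8) ^+ (N + i))
    = q ^+ (8 * N * N) * \prod_(j < N) (1 - q ^+ (4 + r) * (q ^+ 8) ^+ j).
  have -> : q ^+ (8 * N * N) = \prod_(i < N) q ^+ (8 * N).
    by rewrite prodr_const card_ord -exprM.
  rewrite -big_split /=.
  by apply: eq_bigr => i _; rewrite [_ ^+ (N + i)]exprD -[(q ^+ 8) ^+ N]exprM; ring.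
have -> : \prod_(i < N) (q ^+ (8 * N) + - q ^+ (4 + r) * (q ^+ 8) ^+ i)
    = (-1) ^+ N * q ^+ ((4 + r) * N + 8 * 'C(N, 2))
      * \prod_(j < N) (1 - q ^+ (4 - r) * (q ^+ 8) ^+ j).
  rewrite [X in _ = _ * X](reindex_inj rev_ord_inj) /=.
  have -> : (-1) ^+ N * q ^+ ((4 + r) * N + 8 * 'C(N, 2))
      = \prod_(i < N) (- q ^+ (4 + r) * (q ^+ 8) ^+ i).
    rewrite big_split /= prodr_const card_ord [(- q ^+ _) ^+ _]exprNn -!exprM exprD mulrA; congr (_ * _).
    by rewrite -bin2_sum big_mkord exprM -prodrXr.
  rewrite -big_split /=; apply: eq_bigr => i _; rewrite mulrBr mulr1 addrC; congr (_ + _).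
  rewrite -!exprM !mulNr opprK mulrA -!exprD; congr (q ^+ _).
  by have := ltn_ord i; lia.
move=> H; apply: (@varXM_inj _ E).
have ss : (-1) ^+ N * (-1) ^+ N = 1 :> fps int by rewrite -expr2 sqrr_sign.
transitivity ((-1) ^+ N * (\sum_(i < (N + N).+1)
    gbin (q ^+ 8) (N + N) i * q ^+ 8 ^+ 'C(i, 2) *
    q ^+ (8 * N) ^+ (N + N - i) * (- q ^+ (4 + r)) ^+ i)).
  rewrite -H /E exprD /finite_prod -[LHS]mul1r -[X in X * _ = _]ss.
  by ring.
rewrite !mulr_sumr; apply: eq_bigr => i _.
have qE : q ^+ E * q ^+ e (k_of N i)
    = q ^+ 8 ^+ 'C(i, 2) * q ^+ (8 * N) ^+ (N + N - i) * q ^+ (4 + r) ^+ i.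
  by rewrite -!exprM -!exprD theta4_exp_shift // -ltnS.
transitivity ((-1) ^+ (i + N) * gbin (q ^+ 8) (N + N) i * (q ^+ E * q ^+ e (k_of N i))).
  by rewrite qE [(- _) ^+ i]exprNn [(-1) ^+ (i + N)]exprD; ring.
by ring.
Qed.

(** Modulo q^K the finite products for i, j and i + j all agree with the infinite product P, so
    [gbin_pfact] reads gbin P P = P, and P is invertible. *)
Lemma gbin_limit K i j : (K <= i)%N -> (K <= j)%N ->
  fps_eq_upto K (gbin (q ^+ 8) (i + j) i * qpoch (q ^+ 8) (q ^+ 8)) 1.
Proof.
move=> Ki Kj; set P := qpoch _ _.
have P0 : P 0%N = 1.
  by rewrite /P /qpoch /= big_ord1 fcoefB expr0 mulr1 fcoef_varX subr0.
have uP : P \is a GRing.unit by rewrite unfold_in /= /fps_unit P0.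
have PK m : (K <= m)%N -> fps_eq_upto K P (pfact (q ^+ 8) m).
  move=> Km n nK; rewrite /pfact qpoch_stable ?fcoef_varX //.
  exact: leq_trans nK Km.
have refl (f : fps int) : fps_eq_upto K f f by [].
have PV : fps_eq_upto K (gbin (q ^+ 8) (i + j) i * P * P) P.
  move=> n nK; rewrite (PK (i + j)%N) ?(leq_trans Ki (leq_addr _ _)) //.
  rewrite -gbin_pfact; apply: (fps_eq_uptoM _ _ nK); last exact: PK.
  by apply: fps_eq_uptoM; [exact: refl | exact: PK].
have := fps_eq_uptoM PV (refl P^-1).
by rewrite mulrK // divrr.
Qed.

Lemma theta4_product :
  theta4 r = qpoch (q ^+ (4 + r)) (q ^+ 8) * qpoch (q ^+ (4 - r)) (q ^+ 8)
             * qpoch (q ^+ 8) (q ^+ 8).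
Proof.
(* With N = 2n + 1, every i with |i - N| <= n satisfies i >= n + 1 and 2N - i >= n + 1, as
   [gbin_limit] needs in degree n. *)
apply: fpsP => n; pose N := (n + n).+1; have nn := ltnSn n.
have nN : (n < N)%N by rewrite /N; lia.
have s0 : (q ^+ (4 + r)) 0%N = 0 by rewrite fcoef_varX; case: eqP => //; lia.
have t0 : (q ^+ (4 - r)) 0%N = 0 by rewrite fcoef_varX; case: eqP => //; lia.
have x0 : (q ^+ 8) 0%N = 0 by rewrite fcoef_varX.
set P := qpoch (q ^+ 8) _.
have lim : fps_eq_upto n.+1 (qpoch (q ^+ (4 + r)) (q ^+ 8)
    * qpoch (q ^+ (4 - r)) (q ^+ 8) * P) (finite_prod N * P).
  apply: fps_eq_uptoM => //; apply: fps_eq_uptoM => m mn;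
    by rewrite qpoch_stable // (leq_trans mn nN).
rewrite (lim _ nn) finite_triple_product mulr_suml fcoef_sum.
transitivity (\sum_(i < (N + N).+1)
    if e (k_of N i) == n then (-1) ^+ (i + N) else 0 : int); last first.
  apply: eq_bigr => i _; move: (nat_of_ord i) (ltn_ord i) => {}i iN.
  have -> : (-1) ^+ (i + N) * gbin (q ^+ 8) (N + N) i * q ^+ e (k_of N i) * P
      = (-1) ^+ (i + N) * (q ^+ e (k_of N i) * (gbin (q ^+ 8) (N + N) i * P)) by ring.
  rewrite fcoef_signM fcoef_varXM; case: leqP => [en|ne]; last first.
    by rewrite mulr0; case: eqP ne => // ->; rewrite ltnn.
  have ki : (Z.abs (k_of N i) <= Z.of_nat n)%BZ.
    by have : (Z.abs (k_of N i) <= k_of N i * k_of N i)%BZ; move: en; rewrite /e; nia.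
  have -> : (N + N = i + (N + N - i))%N by lia.
  rewrite (@gbin_limit n.+1) ?ltnS ?leq_subr //; [|move: ki; rewrite /k_of /N; lia..].
  by rewrite fcoef1 subn_eq0 eqn_leq en; case: leqP; rewrite ?mulr1 ?mulr0.
pose s := [seq k <- [seq k_of N i | i <- iota 0 (N + N).+1] | e k == n].
transitivity (\sum_(k \in [set k | e k = n]%classic) (sgn k : int));
  first by rewrite thetaE.
rewrite (@fsbigE _ _ _ _ _ s).
- rewrite big_filter_cond big_map.
  rewrite -(big_mkord xpredT (fun i => if e (k_of N i) == n then (-1) ^+ (i + N) else 0)).
  rewrite -[RHS]big_mkcond /=; apply: eq_big => [i|i _].
    by apply/andP/eqP => [[/eqP]|H] //; rewrite H inE.
  rewrite Z.even_sub !even_of_nat -signr_odd oddD.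
  by case: (odd i); case: (odd N).
- rewrite filter_uniq // map_inj_uniq ?iota_uniq // => i j; rewrite /k_of; lia.
- by move=> k /=; rewrite mem_filter => /andP[/eqP].
move=> k /= ek /negP[]; rewrite mem_filter; apply/andP; split; first exact/eqP.
have kn : (Z.abs k <= Z.of_nat n)%BZ.
  by have : (Z.abs k <= k * k)%BZ; move: ek; rewrite /e; nia.
apply/mapP; exists (Z.to_nat (k + Z.of_nat N)); last by rewrite /k_of /N; lia.
by rewrite mem_iota /N; lia.
Qed.
End TripleProduct.

(** * Dilations and sign changes *)

(** The map f(q) -> f(q^d): [fps_subst y] sends q to q y, hence d - 1 here and the hypothesis 0 < d
    later. *)
Notation dil d := (fps_subst (q ^+ d.-1)).
Notation neg_arg := (fps_subst (-1 : fps int)).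

Lemma dil_var d : (0 < d)%N -> dil d q = q ^+ d.
Proof. by case: d => // d _; rewrite fps_subst_var -exprS. Qed.

Lemma neg_arg_var : neg_arg q = - q.
Proof. by rewrite fps_subst_var mulrN1. Qed.

Lemma fcoef_dil d f n : (0 < d)%N ->
  dil d f n = if (d %| n)%N then f (n %/ d)%N else 0.
Proof.
move=> d0; rewrite /=.
have qdX j : ((q * q ^+ d.-1) ^+ j) n = (n == d * j)%N%:R :> int.
  by rewrite -exprS prednK // -exprM fcoef_varX.
under eq_bigr => j _ do rewrite qdX.
case: ifP => dn.
  have nd : (n %/ d < n.+1)%N by rewrite ltnS leq_div.
  rewrite (bigD1 (Ordinal nd)) //= [(d * _)%N]mulnC divnK // eqxx mulr1 big1 ?addr0 //.
  move=> j /eqP jn; case: eqP => [nj|]; last by rewrite mulr0.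
  by case: jn; apply: val_inj; rewrite /= -[LHS](mulKn _ d0) -nj.
rewrite big1 // => j _; case: eqP => [nj|]; last by rewrite mulr0.
by have := dvdn_mulr j (dvdnn d); rewrite -nj dn.
Qed.

Lemma fcoef_neg_arg f n : neg_arg f n = (-1) ^+ n * f n.
Proof.
rewrite /= big_ord_recr /= big1 ?add0r => [|j _]; 
  rewrite mulrN1 [(- q) ^+ _]exprNn fcoef_signM fcoef_varX.
  by rewrite eqxx mulr1 mulrC.
by rewrite gtn_eqF ?ltn_ord // !mulr0.
Qed.

Lemma dil_lattice_sum (I : choiceType) d (e : I -> nat) c : (0 < d)%N ->
  dil d (lattice_sum e c) = lattice_sum (fun i => d * e i)%N c.
Proof.
move=> d0; apply: fpsP => n; rewrite fcoef_dil //; case: ifP => dn.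
  apply: eq_fsbigl; apply/seteqP; split=> i /= H.
    by rewrite H mulnC divnK.
  by rewrite -H mulKn.
rewrite /= fsbig1 // => i /= H; by move: dn; rewrite -H dvdn_mulr.
Qed.

Lemma neg_arg_lattice_sum (I : choiceType) (e : I -> nat) c :
  neg_arg (lattice_sum e c) = lattice_sum e (fun i => (-1) ^+ e i * c i).
Proof.
apply: fpsP => n; rewrite fcoef_neg_arg /= mulr_fsumr.
by apply: eq_fsbigr => i; rewrite inE => /= <-.
Qed.

Lemma dil_phi d m : (0 < d)%N -> dil d (phi m) = phi (d * m).
Proof.
move=> d0; rewrite !thetaE dil_lattice_sum //; congr lattice_sum.
by apply: funext => k; rewrite mulnA.
Qed.

Lemma dil_psi d m : (0 < d)%N -> dil d (psi m) = psi (d * m).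
Proof.
move=> d0; rewrite !thetaE dil_lattice_sum //; congr lattice_sum.
by apply: funext => k; rewrite mulnA.
Qed.

Lemma dil_phim d m : (0 < d)%N -> dil d (phim m) = phim (d * m).
Proof.
move=> d0; rewrite !thetaE dil_lattice_sum //; congr lattice_sum.
by apply: funext => k; rewrite mulnA.
Qed.

Lemma dil_psim d m : (0 < d)%N -> dil d (psim m) = psim (d * m).
Proof.
move=> d0; rewrite !thetaE dil_lattice_sum //; congr lattice_sum.
by apply: funext => k; rewrite mulnA.
Qed.

Lemma in_powers_dil m d f : (0 < d)%N -> (m %| d)%N -> dil d f \in in_powers m.
Proof.
move=> d0 md; apply: in_powers_subst; rewrite -exprS prednK //.
exact: in_powers_varX.
Qed.

Lemma in_powers_phi m d : (0 < d)%N -> (m %| d)%N -> phi d \in in_powers m.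
Proof. by move=> d0 md; rewrite -[d]muln1 -dil_phi // in_powers_dil. Qed.

Lemma in_powers_psi m d : (0 < d)%N -> (m %| d)%N -> psi d \in in_powers m.
Proof. by move=> d0 md; rewrite -[d]muln1 -dil_psi // in_powers_dil. Qed.

Lemma neg_arg_id f : f \in in_powers 2 -> neg_arg f = f.
Proof.
move=> /in_powersP f2; apply: fpsP => n; rewrite fcoef_neg_arg -signr_odd.
by have := f2 n; rewrite dvdn2 negbK; case: odd => [->|] //; rewrite ?mulr0 // mul1r.
Qed.

Lemma lattice_sum_coef0 (e : Z -> nat) (c : Z -> int) :
  e 0%BZ = 0%N -> (forall k, e k = 0%N -> k = 0%BZ) -> lattice_sum e c 0%N = c 0%BZ.
Proof.
move=> e0 e_eq0 /=; rewrite -[RHS](@fsbig_set1 _ _ +%R _ 0%BZ c).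
by apply: eq_fsbigl; apply/seteqP; split=> k /=; [exact: e_eq0 | move=> ->].
Qed.

Lemma phi_coef0 d : (0 < d)%N -> phi d 0%N = 1.
Proof. by move=> d0; rewrite thetaE lattice_sum_coef0 ?muln0 // => k; nia. Qed.
Lemma psi_coef0 d : (0 < d)%N -> psi d 0%N = 1.
Proof. by move=> d0; rewrite thetaE lattice_sum_coef0 ?muln0 // => k; nia. Qed.
Lemma phim_coef0 d : (0 < d)%N -> phim d 0%N = 1.
Proof. by move=> d0; rewrite thetaE lattice_sum_coef0 ?muln0 // => k; nia. Qed.
Lemma psim_coef0 d : (0 < d)%N -> psim d 0%N = 1.
Proof. by move=> d0; rewrite thetaE lattice_sum_coef0 ?muln0 // => k; nia. Qed.

Lemma sign_to_nat k : (0 <= k)%BZ -> (-1) ^+ Z.to_nat k = sgn k :> int.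
Proof.
move=> k0; rewrite -{2}(Z2Nat.id k) // even_of_nat -signr_odd.
by case: odd.
Qed.

Lemma neg_arg_phi : neg_arg (phi 1) = phim 1.
Proof.
rewrite !thetaE neg_arg_lattice_sum; congr lattice_sum; apply: funext => k.
rewrite mulr1 mul1n sign_to_nat; last exact (Zsqr_ge0 k).
by rewrite Z.even_mul; case: Z.even.
Qed.

Lemma neg_arg_psi m : odd m -> neg_arg (psi m) = psim m.
Proof.
move=> om; rewrite !thetaE neg_arg_lattice_sum; congr lattice_sum; apply: funext => k.
rewrite mulr1 exprM -[(-1) ^+ m]signr_odd om sign_to_nat; last exact (psi_exp_ge0 k).
by rewrite Z.even_add Z.even_mul /=; case: Z.even.
Qed.

(** * Theta identities at q^d and at -q^d *)

Section Dilated.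
Variables (d : nat) (d0 : (0 < d)%N).

Let homE := (rmorphD, rmorphB, rmorphM, rmorphXn, rmorphN).
Let dilE := (dil_var d0,
  fun m => @dil_phi d m d0, fun m => @dil_psi d m d0,
  fun m => @dil_phim d m d0, fun m => @dil_psim d m d0, muln1).

Lemma phi_split : phi d = phi (d * 4) + 2 * q ^+ d * psi (d * 8).
Proof.
have := congr1 (dil d) phi_split4; rewrite !homE /= !dilE => ->.
ring.
Qed.

Lemma psi_sqr_dil : psi d ^+ 2 = phi d * psi (d * 2).
Proof. by have := congr1 (dil d) psi_sqr; rewrite !homE /= !dilE. Qed.

Lemma psi_psi3_dil : psi d * psi (d * 3)
  = phi (d * 6) * psi (d * 4) + q ^+ d * (phi (d * 2) * psi (d * 12)).
Proof. by have := congr1 (dil d) psi_psi3; rewrite !homE /= !dilE. Qed.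

Lemma psi_psi7_dil : psi d * psi (d * 7)
  = phi (d * 28) * psi (d * 8) + q ^+ d * (psi (d * 14) * psi (d * 2))
    + q ^+ (d * 6) * (phi (d * 4) * psi (d * 56)).
Proof. by have := congr1 (dil d) psi_psi7; rewrite !homE /= !dilE exprM. Qed.

(** The sign is changed at d = 1 and the result dilated afterwards, so that q^d becomes -q^d for
    even d as well. *)
Lemma phim_split : phim d = phi (d * 4) - 2 * q ^+ d * psi (d * 8).
Proof.
have := congr1 neg_arg phi_split4.
rewrite !rmorphD !rmorphM /= neg_arg_phi neg_arg_var !neg_arg_id ?in_powers_phi ?in_powers_psi //.
by move/(congr1 (dil d)); rewrite !homE /= !dilE => ->; ring.
Qed.

Lemma psim_sqr : psim d ^+ 2 = phim d * psi (d * 2).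
Proof.
have := congr1 neg_arg psi_sqr.
rewrite rmorphXn rmorphM /= neg_arg_psi // neg_arg_phi neg_arg_id ?in_powers_psi //.
by move/(congr1 (dil d)); rewrite !homE /= !dilE.
Qed.

Lemma psim_psim3 : psim d * psim (d * 3)
  = phi (d * 6) * psi (d * 4) - q ^+ d * (phi (d * 2) * psi (d * 12)).
Proof.
have := congr1 neg_arg psi_psi3.
rewrite !rmorphD !rmorphM /= neg_arg_var (@neg_arg_psi 1) // (@neg_arg_psi 3) // !neg_arg_id
  ?in_powers_phi ?in_powers_psi //.
by move/(congr1 (dil d)); rewrite !homE /= !dilE mulNr.
Qed.
End Dilated.

(* If E(q) = -E(q^2) then the order of E in q can be doubled indefinitely. *)
Lemma descent (E : nat -> fps int) :
  (forall d, (0 < d)%N -> E d = - E (d * 2)%N) ->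
  (forall d, (0 < d)%N -> E d \in in_powers d) ->
  (forall d, (0 < d)%N -> E d 0%N = 0) ->
  forall d, (0 < d)%N -> E d = 0.
Proof.
move=> Edbl Ein E0 d d0; apply: fpsP => n.
have [m] := ubnP (n.+1 - d)%N; elim: m d d0 => // m IHm d d0 ltm.
have [nd|dn] := ltnP n d.
  have [->|n0] := posnP n; first exact: E0.
  by have /in_powersP -> // := Ein d d0; rewrite gtnNdvd.
by rewrite Edbl // fcoefN IHm ?oppr0 //; lia.
Qed.

(** * Quadratic relations among theta series *)

Lemma fps_sqr_inj (f g : fps int) :
  f 0%N = 1 -> g 0%N = 1 -> f ^+ 2 = g ^+ 2 -> f = g.
Proof.
move=> f0 g0 fg; apply/eqP; rewrite -subr_eq0; apply/eqP.
apply: (@fps_mul_eq0r _ (f + g)); first by rewrite fcoefD f0 g0.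
by rewrite mulrC -subr_sqr fg subrr.
Qed.

Lemma fps_2_inj (f g : fps int) : 2 * f = 2 * g -> f = g.
Proof.
by move=> fg; apply: (@fps_mulI _ 2); rewrite // /= -[2]mulr1 fcoef_natM.
Qed.

Ltac solve_dvd := first
  [ by [] | exact: dvdnn | exact: (dvdn_mulr _ (dvdnn _)) | by apply: dvdn_mull ].

Ltac in_pow := lazymatch goal with
  | |- is_true (in_mem (phi _) _) =>
      apply: in_powers_phi; [by rewrite ?muln_gt0 //; lia | solve_dvd]
  | |- is_true (in_mem (psi _) _) =>
      apply: in_powers_psi; [by rewrite ?muln_gt0 //; lia | solve_dvd]
  | |- is_true (in_mem (fps_var ^+ _) _) => apply: in_powers_varX; solve_dvd
  | |- is_true (in_mem (_%:R) _) => exact: rpred_nat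
  | |- is_true (in_mem (_ + _) _) => apply: rpredD; in_pow
  | |- is_true (in_mem (- _) _) => rewrite rpredN; in_pow
  | |- is_true (in_mem (_ * _) _) => apply: rpredM; in_pow
  | |- is_true (in_mem (_ ^+ _) _) => apply: rpredX; in_pow
  | |- is_true (in_mem (_ ^-1) _) => apply: in_powersV; in_pow
  end.

Lemma theta4_coef0 r : (r < 4)%N -> theta4 r 0%N = 1.
Proof.
move=> r4; rewrite thetaE lattice_sum_coef0 ?Z.mul_0_r // => k.
by have : (Z.abs k <= k * k)%BZ; nia.
Qed.

(** Certificate for a linear combination: with the cofactor c supplied, only a ring identity remains
    to be checked. *)
Lemma lincomb1 (R : comNzRingType) (c l r a b : R) :
  l = r -> a - b = c * (l - r) -> a = b.
Proof. by move->; rewrite subrr mulr0 => /subr0_eq. Qed.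

Lemma lincomb2 (R : comNzRingType) (c l r c' l' r' a b : R) :
  l = r -> l' = r' -> a - b = c * (l - r) + c' * (l' - r') -> a = b.
Proof. by move=> -> ->; rewrite !subrr !mulr0 addr0 => /subr0_eq. Qed.

Arguments lincomb1 {R} c {l r a b}.
Arguments lincomb2 {R} c {l r} c' {l' r' a b} _ _.

(** By [phi_split] and psi_4d^2 = phi_4d psi_8d the difference of the two sides at d is minus that
    at 2d, so [descent] applies. *)
Lemma phi_sqr d : (0 < d)%N ->
  phi d ^+ 2 = phi (d * 2) ^+ 2 + 4 * q ^+ d * psi (d * 4) ^+ 2.
Proof.
move=> d0; apply/eqP; rewrite -subr_eq0; apply/eqP; move: d d0.
apply: (descent (E := fun d => phi d ^+ 2 -
  (phi (d * 2) ^+ 2 + 4 * q ^+ d * psi (d * 4) ^+ 2))) => e e0.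
- rewrite {1}(phi_split e0) psi_sqr_dil ?muln_gt0 ?e0 // -!mulnA.
  by rewrite (exprM q e 2); ring.
- by in_pow.
- rewrite fcoefB fcoefD -!mulrA fcoef_natM fcoef_varXM leqn0 (gtn_eqF e0) mulr0.
  by rewrite !expr2 !fcoefM0 !phi_coef0 ?muln_gt0 ?e0.
Qed.

Lemma phi_phim d : (0 < d)%N -> phi d * phim d = phim (d * 2) ^+ 2.
Proof.
move=> d0; have d2 : (0 < d * 2)%N by lia.
have -> : phim (d * 2) = phi (d * 8) - 2 * (q ^+ d) ^+ 2 * psi (d * 16).
  by rewrite (phim_split d2) -!mulnA -exprM.
rewrite (phi_split d0) (phim_split d0).
have h1 : psi (d * 8) ^+ 2 = phi (d * 8) * psi (d * 16).
  by rewrite psi_sqr_dil -?mulnA //; lia.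
have h2 : phi (d * 4) ^+ 2 = phi (d * 8) ^+ 2 + 4 * q ^+ (d * 4) * psi (d * 16) ^+ 2.
  by rewrite phi_sqr -?mulnA //; lia.
rewrite (exprM q d 4) in h2.
by apply: (lincomb2 (- 4 * (q ^+ d) ^+ 2) 1 h1 h2); ring.
Qed.

Lemma psi_psim d : (0 < d)%N -> psi d * psim d = psi (d * 2) * phim (d * 2).
Proof.
move=> d0; have d2 : (0 < d * 2)%N by lia.
apply: fps_sqr_inj; rewrite ?fcoefM0 ?psi_coef0 ?psim_coef0 ?phim_coef0 //.
rewrite !exprMn psi_sqr_dil // psim_sqr // -phi_phim //; ring.
Qed.

Lemma phi_psim d : (0 < d)%N -> phi d * psim d = phim (d * 2) * psi d.
Proof.
move=> d0; have d2 : (0 < d * 2)%N by lia.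
apply: (@fps_mulI _ (psi (d * 2))); first by rewrite psi_coef0.
have h1 := psi_sqr_dil d0; have h2 := psi_psim d0.
by apply: (lincomb2 (- psim d) (psi d) h1 h2); ring.
Qed.

(** The squares of [theta4_sqrD] and [theta4_sqrB] differ by 4 q times the square of the left side,
    and also by psim_1^2 (phi_1^2 - phi_2^2), to which [phi_sqr] applies. Constant terms select the
    root. *)
Lemma theta4_mul : theta4 1 * theta4 3 = psim 1 * psi 4.
Proof.
apply: fps_sqr_inj; rewrite ?fcoefM0 ?psi_coef0 ?psim_coef0 ?theta4_coef0 //.
apply: (@varXM_inj _ 1); apply: (@fps_mulI _ 4).
  by rewrite -[4]mulr1 fcoef_natM.
have h1 := theta4_sqrD; rewrite -(phi_psim (d := 1)) // in h1.
have h2 := theta4_sqrB; have h3 := phi_sqr (d := 1) isT.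
rewrite !mul1n !expr1 in h3 *.
transitivity ((theta4 1 ^+ 2 + q * theta4 3 ^+ 2) ^+ 2
    - (theta4 1 ^+ 2 - q * theta4 3 ^+ 2) ^+ 2); first by ring.
by rewrite h1 h2 exprMn h3; ring.
Qed.

(** * The quotient S/T as a quotient of theta series *)

HB.lock Definition G (d : nat) : fps int := RGG_S (q ^+ d) / RGG_T (q ^+ d).

Lemma qpoch_coef0 (a x : fps int) : a 0%N = 0 -> qpoch a x 0%N = 1.
Proof. by move=> a0; rewrite /= big_ord1 fcoefB expr0 mulr1 a0 subr0. Qed.

Lemma fps_unit1 (f : fps int) : f 0%N = 1 -> f \is a GRing.unit.
Proof. by move=> f0; rewrite unfold_in /= /fps_unit f0. Qed.

Lemma RGG_SE x : RGG_S x
  = (qpoch x (x ^+ 8) * qpoch (x ^+ 4) (x ^+ 8) * qpoch (x ^+ 7) (x ^+ 8))^-1.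
Proof. exact: div1r. Qed.

Lemma RGG_TE x : RGG_T x
  = (qpoch (x ^+ 3) (x ^+ 8) * qpoch (x ^+ 4) (x ^+ 8) * qpoch (x ^+ 5) (x ^+ 8))^-1.
Proof. exact: div1r. Qed.

Lemma RGG_unit (x : fps int) : x 0%N = 0 ->
  (RGG_S x \is a GRing.unit) * (RGG_T x \is a GRing.unit).
Proof.
move=> x0; have X k : (x ^+ k.+1) 0%N = 0 by rewrite exprS fcoefM0 x0 mul0r.
by split; rewrite (RGG_SE, RGG_TE) unitrV fps_unit1 // !fcoefM0 !qpoch_coef0 // !mulr1.
Qed.

Lemma fps_substV y (f : fps int) : f 0%N = 1 ->
  fps_subst y f^-1 = (fps_subst y f)^-1.
Proof.
move=> f0; have uf := fps_unit1 f0.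
have usf : fps_subst y f \is a GRing.unit by apply: fps_unit1; rewrite fps_subst0.
apply: (mulrI usf); rewrite divrr //.
transitivity (fps_subst y (f * f^-1)); first by rewrite rmorphM.
by rewrite divrr // rmorph1.
Qed.

Lemma RGG_subst y (x : fps int) : x 0%N = 0 ->
  (fps_subst y (RGG_S x) = RGG_S (fps_subst y x)) *
  (fps_subst y (RGG_T x) = RGG_T (fps_subst y x)).
Proof.
move=> x0; have X k : (x ^+ k.+1) 0%N = 0 by rewrite exprS fcoefM0 x0 mul0r.
split; rewrite (RGG_SE, RGG_TE) fps_substV ?(RGG_SE, RGG_TE).
- by rewrite !rmorphM /= (fps_subst_qpoch _ x0 (X 7%N)) (fps_subst_qpoch _ (X 3%N) (X 7%N))
    (fps_subst_qpoch _ (X 6%N) (X 7%N)) !rmorphXn.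
- by rewrite !fcoefM0 !qpoch_coef0 ?mulr1.
- by rewrite !rmorphM /= (fps_subst_qpoch _ (X 2%N) (X 7%N))
    (fps_subst_qpoch _ (X 3%N) (X 7%N)) (fps_subst_qpoch _ (X 4%N) (X 7%N)) !rmorphXn.
- by rewrite !fcoefM0 !qpoch_coef0 ?mulr1.
Qed.

Lemma varX_coef0 d : (0 < d)%N -> (q ^+ d) 0%N = 0.
Proof. by case: d => // d _; rewrite fcoef_varX. Qed.

Lemma RGG_coef0 (x : fps int) : x 0%N = 0 ->
  (RGG_S x 0%N = 1) * (RGG_T x 0%N = 1).
Proof.
move=> x0; have X k : (x ^+ k.+1) 0%N = 0 by rewrite exprS fcoefM0 x0 mul0r.
have inv1 (f : fps int) : f 0%N = 1 -> f^-1 0%N = 1.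
  move=> f0; have := congr1 (fun g : fps int => g 0%N) (divrr (fps_unit1 f0)).
  by rewrite fcoefM0 f0 mul1r.
by split; rewrite (RGG_SE, RGG_TE); apply: inv1; rewrite !fcoefM0 !qpoch_coef0 ?mulr1.
Qed.

Lemma G_unit d : (0 < d)%N -> G d \is a GRing.unit.
Proof.
move=> d0; have [uS uT] := RGG_unit (varX_coef0 d0).
by rewrite -unitrV in uT; rewrite !G.unlock (unitrMr _ uS).
Qed.

Lemma dil_G d : (0 < d)%N -> dil d (G 1) = G d.
Proof.
move=> d0; rewrite !G.unlock expr1 rmorphM /=.
have q0 : q 0%N = 0 by [].
rewrite fps_substV; last by rewrite (RGG_coef0 q0).2.
have [eS eT] := RGG_subst (q ^+ d.-1) q0.
rewrite (dil_var d0) in eS eT.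
exact: (congr2 (fun a b => a / b) eS eT).
Qed.

(** The factors (q^4;q^8) cancel in S/T, and (q^8;q^8) is common to both triple products. *)
Lemma G_theta4 : G 1 * theta4 3 = theta4 1.
Proof.
rewrite !G.unlock expr1 !theta4_product // RGG_SE RGG_TE invrK.
have u k : (0 < k)%N -> qpoch (q ^+ k) (q ^+ 8) \is a GRing.unit.
  by move=> k0; apply: fps_unit1; rewrite qpoch_coef0 ?varX_coef0.
have := u 1%N isT; have := u 4%N isT; have := u 7%N isT.
rewrite -[(4 - 3)%N]/1%N -[(4 - 1)%N]/3%N -[(4 + 1)%N]/5%N -[(4 + 3)%N]/7%N !expr1.
move: (qpoch q _) (qpoch (q ^+ 3) _) (qpoch (q ^+ 4) _) (qpoch (q ^+ 5) _)
  (qpoch (q ^+ 7) _) (qpoch (q ^+ 8) _) => q1 q3 q4 q5 q7 q8 u7 u4 u1.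
have u147 : q1 * q4 * q7 \is a GRing.unit by rewrite !unitrM u1 u4 u7.
transitivity ((q1 * q4 * q7)^-1 * (q1 * q4 * q7) * (q5 * q3 * q8)); first by ring.
by rewrite mulVr // mul1r.
Qed.

(** * The quotient G *)

Lemma G_coef0 d : (0 < d)%N -> G d 0%N = 1.
Proof.
move=> d0; have [S0 T0] := RGG_coef0 (varX_coef0 d0).
have [_ uT] := RGG_unit (varX_coef0 d0).
have := congr1 (fun f : fps int => f 0%N) (divrK uT (RGG_S (q ^+ d))).
rewrite (fcoefM0 (RGG_S _ / RGG_T _)) S0 T0 mulr1 => G0.
by rewrite G.unlock; exact: G0.
Qed.

(** Inverses and theta series become free variables, so relations such as G G^-1 = 1 have to be
    supplied through [lincomb1] and [lincomb2]. *)
Ltac fps_ring :=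
  repeat match goal with
  | |- context [GRing.inv ?f] => generalize (GRing.inv f); intro
  | |- context [phi ?d] => generalize (phi d); intro
  | |- context [psi ?d] => generalize (psi d); intro
  | |- context [psim ?d] => generalize (psim d); intro
  | |- context [theta4 ?d] => generalize (theta4 d); intro
  | |- context [fps_subst ?y (G ?d)] => generalize (fps_subst y (G d)); intro
  | |- context [G ?d] => generalize (G d); intro
  end; ring.

Lemma GV d : (0 < d)%N -> G d * (G d)^-1 = 1.
Proof. by move=> d0; rewrite divrr // G_unit. Qed.

(** After multiplication by [psim 1] the left side is twice the square of [theta4 1], by
    [theta4_mul]: the sum of [theta4_sqrD] and [theta4_sqrB]. Their difference gives [GV_psiB]. *)
Lemma G_psiD d : (0 < d)%N -> 2 * (G d * psi (d * 4)) = phi d + phi (d * 2).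
Proof.
move=> d0; rewrite -dil_G //.
have : 2 * (G 1 * psi 4) = phi 1 + phi 2.
  apply: (@fps_mulI _ (psim 1)); first by rewrite psim_coef0.
  have h1 := theta4_sqrD; rewrite -(phi_psim (d := 1)) // in h1.
  have h2 := theta4_sqrB; have h3 := theta4_mul; have h4 := G_theta4.
  transitivity (2 * G 1 * (psim 1 * psi 4)); first by fps_ring.
  transitivity (phi 1 * psim 1 + phi 2 * psim 1); last by fps_ring.
  by rewrite -h1 -h2 -h3 -h4; fps_ring.
move/(congr1 (dil d)); rewrite !(rmorphD, rmorphM, rmorph_nat) /=.
by rewrite !dil_phi // dil_psi // muln1.
Qed.

Lemma GV_psiB d : (0 < d)%N ->
  2 * (q ^+ d * (G d)^-1 * psi (d * 4)) = phi d - phi (d * 2).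
Proof.
move=> d0; rewrite -dil_G // -fps_substV ?G_coef0 //.
have : 2 * (q * (G 1)^-1 * psi 4) = phi 1 - phi 2.
  apply: (@fps_mulI _ (psim 1)); first by rewrite psim_coef0.
  have h1 := theta4_sqrD; rewrite -(phi_psim (d := 1)) // in h1.
  have h2 := theta4_sqrB; have h3 := theta4_mul.
  have h4 : theta4 3 = (G 1)^-1 * theta4 1.
    by rewrite -G_theta4 mulrA mulVr ?mul1r // G_unit.
  transitivity (2 * q * (G 1)^-1 * (psim 1 * psi 4)); first by fps_ring.
  transitivity (phi 1 * psim 1 - phi 2 * psim 1); last by fps_ring.
  by rewrite -h1 -h2 -h3 {1}h4; rewrite h4; fps_ring.
move/(congr1 (dil d)); rewrite !(rmorphB, rmorphM, rmorph_nat) /=.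
by rewrite !dil_phi // dil_psi // muln1 dil_var.
Qed.

Section Doubling.
Variables (d : nat) (d0 : (0 < d)%N).
Local Notation x := (q ^+ d).
Local Notation g := (G d).
Local Notation i := (G d)^-1.
Local Notation g2 := (G (d * 2)).
Local Notation i2 := (G (d * 2))^-1.

Lemma G_phi : (g + x * i) * psi (d * 4) = phi d.
Proof.
apply: fps_2_inj; have h1 := G_psiD d0; have h2 := GV_psiB d0.
by apply: (lincomb2 1 1 h1 h2); fps_ring.
Qed.

Lemma G_phi2 : (g - x * i) * psi (d * 4) = phi (d * 2).
Proof.
apply: fps_2_inj; have h1 := G_psiD d0; have h2 := GV_psiB d0.
by apply: (lincomb2 1 (-1) h1 h2); fps_ring.
Qed.

Let d2 : (0 < d * 2)%N. Proof. lia. Qed.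

Let hD : 2 * (g2 * psi (d * 8)) = phi (d * 2) + phi (d * 4).
Proof. by have := G_psiD d2; rewrite -!mulnA. Qed.

Let hB : 2 * (x ^+ 2 * i2 * psi (d * 8)) = phi (d * 2) - phi (d * 4).
Proof. by have := GV_psiB d2; rewrite -!mulnA (exprM q d 2). Qed.

(** Inserting [phi_split] into [G_psiD] leaves the same formula at 2d plus 2 x psi_8d. *)
Lemma G_psi_double : g * psi (d * 4) = psi (d * 8) * (g2 + x).
Proof.
apply: fps_2_inj; have := G_psiD d0; rewrite (phi_split d0) => h.
by apply: (lincomb2 1 (-1) h hD); fps_ring.
Qed.

Lemma GV_psi_double : i * psi (d * 4) = psi (d * 8) * (1 - x * i2).
Proof.
apply: (@varXM_inj _ d); apply: fps_2_inj.
have := GV_psiB d0; rewrite (phi_split d0) => h.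
by apply: (lincomb2 1 1 h hB); fps_ring.
Qed.

(** The modular equation of degree 2, obtained as the quotient of the two preceding identities. *)
Lemma G_double : g ^+ 2 * (g2 - x) = g2 * (g2 + x).
Proof.
apply: (@fps_mulI _ (psi (d * 8))); first by rewrite psi_coef0 //; lia.
have e1 : g * i = 1 by exact: GV.
have e2 : g2 * i2 = 1 by exact: GV.
have h1 := G_psi_double; have h2 := GV_psi_double.
transitivity (g ^+ 2 * g2 * (psi (d * 8) * (1 - x * i2))).
  by apply: (lincomb1 (psi (d * 8) * g ^+ 2 * x) e2); fps_ring.
by rewrite -h2; apply: (lincomb2 (g * g2 * psi (d * 4)) g2 e1 h1); fps_ring.
Qed.

End Doubling.

(** The change q -> -q exchanges G_2d - x and G_2d + x in [G_double]. Multiplying both versions and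
    cancelling these factors gives (G(x) G(-x))^2 = G(x^2)^2, and constant terms fix the sign. *)
Lemma G_neg d : odd d ->
  RGG_S (- q ^+ d) / RGG_T (- q ^+ d) = G (d * 2) / G d.
Proof.
move=> od; have d0 : (0 < d)%N by case: d od.
have d2 : (0 < d * 2)%N by lia.
have x0 := varX_coef0 d0.
have nx : neg_arg (q ^+ d) = - q ^+ d.
  by rewrite rmorphXn /= neg_arg_var exprNn -signr_odd od expr1 mulN1r.
have -> : RGG_S (- q ^+ d) / RGG_T (- q ^+ d) = neg_arg (G d).
  rewrite G.unlock rmorphM /= fps_substV; last by rewrite (RGG_coef0 x0).2.
  have [eS eT] := RGG_subst (-1) x0; rewrite nx in eS eT.
  exact: (congr2 (fun a b => a / b) (esym eS) (esym eT)).
have n2 : neg_arg (G (d * 2)) = G (d * 2).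
  by apply: neg_arg_id; rewrite -dil_G //; apply: in_powers_dil; rewrite // dvdn_mull.
have m0 : neg_arg (G d) 0%N = 1 by rewrite fps_subst0 G_coef0.
have h1 := G_double d0; have := congr1 neg_arg h1.
rewrite !(rmorphM, rmorphB, rmorphD, rmorphXn) /= n2.
have -> : neg_arg q ^+ d = - q ^+ d by rewrite -nx rmorphXn.
move=> h2.
suff h : G d * neg_arg (G d) = G (d * 2).
  by rewrite -h mulrC mulKr // G_unit.
apply: fps_sqr_inj; rewrite ?fcoefM0 ?G_coef0 ?m0 ?mulr1 //.
apply: (@fps_mulI _ ((G (d * 2) - q ^+ d) * (G (d * 2) + q ^+ d))).
  by rewrite fcoefM0 fcoefB fcoefD x0 G_coef0.
transitivity ((G d ^+ 2 * (G (d * 2) - q ^+ d))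
    * (neg_arg (G d) ^+ 2 * (G (d * 2) - - q ^+ d))); first by fps_ring.
by rewrite h1 h2; fps_ring.
Qed.

(** * Coefficient identities *)

Lemma vanishes_on_in m r (f : fps int) :
  f \in in_powers m -> 0 <> r %[mod m] -> vanishes_on m r f.
Proof. by move=> fm mr; rewrite -[f]mul1r -(expr0 q); apply: vanishes_on_shift. Qed.

Lemma vanishes_on_dvd m m' r (f : fps int) :
  (m' %| m)%N -> vanishes_on m' r f -> vanishes_on m r f.
Proof.
move=> mm van n nr; apply: van.
by rewrite -(modn_dvdm n mm) nr modn_dvdm.
Qed.

Lemma vanishes_on_quot m r (c k : nat) (M F N : fps int) :
  M \in in_powers m -> M 0%N = 1 -> (0 < c)%N -> c%:R * q ^+ k * M * F = N ->
  vanishes_on m (r + k) N -> vanishes_on m r F.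
Proof. by move=> Mm M0 c0 <-; apply: vanishes_on_div. Qed.

(** E is the stray monomial: its exponent may lie in the class of r, and only its coefficient at a
    has to vanish. *)
Lemma coef_opp (X Y E : fps int) m r k a b :
  vanishes_on m r (X + q ^+ k * Y + E) -> a = (k + b)%N -> a = r %[mod m] ->
  E a = 0 -> X a = - Y b.
Proof.
move=> van ak ar Ea; have := van a ar.
rewrite !fcoefD Ea addr0 fcoef_varXM {2 3}ak leq_addr addKn => /eqP.
by rewrite addr_eq0 => /eqP.
Qed.

Lemma coef_eq (X Y E : fps int) m r k a b :
  vanishes_on m r (X - q ^+ k * Y + E) -> a = (k + b)%N -> a = r %[mod m] ->
  E a = 0 -> X a = Y b.
Proof.
rewrite -mulrN => van ak ar Ea.
by rewrite (coef_opp van ak ar Ea) fcoefN opprK.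
Qed.

Lemma fcoef_monomial (c j a : nat) : a != j -> (c%:R * q ^+ j) a = 0.
Proof. by move=> aj; rewrite fcoef_natM fcoef_varX (negbTE aj) mulr0. Qed.

Lemma fcoefN_monomial (c j a : nat) : a != j -> (- (c%:R * q ^+ j)) a = 0.
Proof. by move=> aj; rewrite fcoefN fcoef_monomial ?oppr0. Qed.

Ltac van := repeat apply: vanishes_onD;
  first [ apply: vanishes_on_shift; [by in_pow | by apply/eqP]
        | apply: vanishes_on_in; [by in_pow | by apply/eqP] ].

Ltac coef0 := by rewrite ?fcoefM0 ?psi_coef0 ?phi_coef0 ?phim_coef0 ?mulr1.

Notation Gi d := (G d)^-1.

Lemma phi1E : phi 1 = phi 4 + 2 * q * psi 8.
Proof. exact: (phi_split (d := 1) isT). Qed.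
Lemma phi2E : phi 2 = phi 8 + 2 * q ^+ 2 * psi 16.
Proof. exact: (phi_split (d := 2) isT). Qed.
Lemma phi2_sqrE : phi 2 ^+ 2 = phi 4 ^+ 2 + 4 * q ^+ 2 * psi 8 ^+ 2.
Proof. exact: (phi_sqr (d := 2) isT). Qed.
Lemma psi4_sqrE : psi 4 ^+ 2 = phi 4 * psi 8.
Proof. exact: (psi_sqr_dil (d := 4) isT). Qed.
Lemma G1_phi : (G 1 + q * Gi 1) * psi 4 = phi 1.
Proof. exact: (G_phi (d := 1) isT). Qed.
Lemma G1_phi2 : (G 1 - q * Gi 1) * psi 4 = phi 2.
Proof. exact: (G_phi2 (d := 1) isT). Qed.

Lemma G_coef_odd n : G 1 (2 * n + 1)%N = Gi 1 (2 * n)%N.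
Proof.
apply: (@coef_eq _ _ 0 2 1 1); [|lia|by rewrite mulnC modnMDl|by []].
apply: (@vanishes_on_quot _ _ 1 0 (psi 4) _ (phi 2)); [by in_pow|by coef0|by []| |].
  by rewrite -G1_phi2; ring.
by van.
Qed.

Lemma G_coef_mod4 n : G 1 (4 * n + 2)%N = - Gi 1 (4 * n + 1)%N.
Proof.
apply: (@coef_opp _ _ 0 4 2 1); [|lia|by rewrite mulnC modnMDl|by []].
apply: (@vanishes_on_quot _ _ 1 0 (psi 4) _ (phi 4 + q ^+ 1 * (2 * psi 8)));
  [by in_pow|by coef0|by []| |].
  by apply: (lincomb2 1 1 G1_phi phi1E); fps_ring.
by van.
Qed.

Lemma Gsqr_coef_odd n : (G 1 ^+ 2) (2 * n + 3)%N = - (Gi 1 ^+ 2) (2 * n + 1)%N.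
Proof.
apply: (@coef_opp _ _ (- (2 * q ^+ 1)) 2 1 2);
  [|lia|by rewrite mulnC modnMDl|by rewrite fcoefN_monomial //; lia].
apply: (@vanishes_on_quot _ _ 1 0 (psi 4 * psi 4) _ (phi 2 * phi 2));
  [by in_pow|by coef0|by []| |].
  by rewrite -G1_phi2; apply: (lincomb1 (2 * q * psi 4 * psi 4) (GV (d := 1) isT)); fps_ring.
by van.
Qed.

(** The product of [G1_phi] and [G1_phi2], divided by psi_4^2 = phi_4 psi_8. The first term of phi_1
    = phi_4 + 2 q psi_8 cancels phi_4, so the inverse of phi_4 survives only in odd exponents and
    even classes can be read modulo 8. *)
Lemma G1_sqrB_psi8 : psi 8 * (G 1 ^+ 2 - q ^+ 2 * Gi 1 ^+ 2)
  = phi 8 + q ^+ 2 * (2 * psi 16) + q ^+ 1 * (2 * psi 8 * phi 2 * (phi 4)^-1).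
Proof.
have v : phi 4 * (phi 4)^-1 = 1 by rewrite divrr // fps_unit1 // phi_coef0.
apply: (@fps_mulI _ (phi 4)); first by rewrite phi_coef0.
transitivity (psi 4 ^+ 2 * (G 1 ^+ 2 - q ^+ 2 * Gi 1 ^+ 2)).
  by rewrite psi4_sqrE; fps_ring.
transitivity (((G 1 + q * Gi 1) * psi 4) * ((G 1 - q * Gi 1) * psi 4)); first by fps_ring.
rewrite G1_phi G1_phi2 phi1E.
by apply: (lincomb2 (phi 4) (- (2 * q * psi 8 * phi 2)) phi2E v); fps_ring.
Qed.

Lemma Gsqr_coef_mod8 n a : a \in [:: 4%N; 6%N] ->
  (G 1 ^+ 2) (8 * n + a)%N = (Gi 1 ^+ 2) (8 * n + (a - 2))%N.
Proof.
move=> a46; have a2 : (2 <= a)%N by case/or3P: a46 => // /eqP->.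
apply: (@coef_eq _ _ 0 8 a 2); [|lia|by rewrite mulnC modnMDl|by []].
apply: (@vanishes_on_quot _ _ 1 0 (psi 8)); [by in_pow|by coef0|by []| |].
  by rewrite addr0 expr0 !mul1r; exact: G1_sqrB_psi8.
have [->|->] : a = 4%N \/ a = 6%N by case/or3P: a46 => // /eqP->; [left|right].
  apply: vanishes_onD; first by van.
  by apply: (@vanishes_on_dvd _ 2) => //; van.
apply: vanishes_onD; first by van.
by apply: (@vanishes_on_dvd _ 2) => //; van.
Qed.

Lemma G_exp4_coef n : (G 1 ^+ 4) (4 * n + 6)%N = - (Gi 1 ^+ 4) (4 * n + 2)%N.
Proof.
(* For u = G - q/G, G^4 + q^4/G^4 = u^4 + 4 q u^2 + 2 q^2. Besides this 2 q^2, another 8 q^2 is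
   removed to cancel 8 q^2 phi_4^2 psi_8^2 = 8 q^2 psi_4^4, which comes from phi_2^4. *)
apply: (@coef_opp _ _ (- (10 * q ^+ 2)) 4 2 4);
  [|lia|by rewrite mulnC modnMDl|by rewrite fcoefN_monomial //; lia].
apply: (@vanishes_on_quot _ _ 1 0 (psi 4 * psi 4 * psi 4 * psi 4) _
  (phi 4 ^+ 4 + q ^+ 4 * (16 * psi 8 ^+ 4) + q ^+ 1 * (4 * phi 4 ^+ 2 * psi 4 ^+ 2)
   + q ^+ 3 * (16 * psi 8 ^+ 2 * psi 4 ^+ 2)));
  [by in_pow|by coef0|by []| |by van].
transitivity (((G 1 - q * Gi 1) * psi 4) ^+ 4 + 4 * q * psi 4 ^+ 2 *
    ((G 1 - q * Gi 1) * psi 4) ^+ 2 - 8 * q ^+ 2 * (psi 4 ^+ 2) ^+ 2).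
  have e := GV (d := 1) isT.
  apply: (lincomb1 (psi 4 ^+ 4 * q * (4 * (G 1 ^+ 2 + q ^+ 2 * Gi 1 ^+ 2)
    - 6 * q * (G 1 * Gi 1) - 6 * q + 8 * q)) e).
  by fps_ring.
rewrite G1_phi2 psi4_sqrE (exprM _ 2 2) phi2_sqrE.
by fps_ring.
Qed.

(** * Products and quotients of two values of G *)

Lemma phi3E : phi 3 = phi 12 + 2 * q ^+ 3 * psi 24.
Proof. exact: (phi_split (d := 3) isT). Qed.

(** The cross terms of phi_2 phi_6 add up to 2 q^2 psi_4 psi_12 by [psi_psi3_dil]; as psi_4 psi_12
    is the divisor for p = 3, they become a single monomial. *)
Lemma phi2_phi6E : phi 2 * phi 6
  = phi 8 * phi 24 + 4 * q ^+ 8 * psi 16 * psi 48 + 2 * q ^+ 2 * (psi 4 * psi 12).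
Proof.
have h6 : phi 6 = phi 24 + 2 * q ^+ 6 * psi 48 by exact: (phi_split (d := 6) isT).
have h4 : psi 4 * psi 12 = phi 24 * psi 16 + q ^+ 4 * (phi 8 * psi 48).
  exact: (psi_psi3_dil (d := 4) isT).
by rewrite h4 h6 phi2E; fps_ring.
Qed.

(** The products (phi_1 - phi_2)(phi_p + phi_2p) and (phi_1 + phi_2)(phi_p - phi_2p) add up to twice
    the right side. The summand 0 is the empty correction of [coef_opp]. *)
Lemma G_quotient_phi p : (0 < p)%N ->
  2 * q ^+ 1 * (psi 4 * psi (p * 4))
    * (Gi 1 * G p + q ^+ p.-1 * (G 1 * Gi p) + 0)
  = phi 1 * phi p - phi 2 * phi (p * 2).
Proof.
move=> p0; apply: fps_2_inj.
have a1 : 2 * (G 1 * psi 4) = phi 1 + phi 2 by exact: (G_psiD (d := 1) isT).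
have b1 : 2 * (q ^+ 1 * Gi 1 * psi 4) = phi 1 - phi 2 by exact: (GV_psiB (d := 1) isT).
have qp : q ^+ p = q * q ^+ p.-1 by rewrite -exprS prednK.
transitivity ((2 * (q ^+ 1 * Gi 1 * psi 4)) * (2 * (G p * psi (p * 4)))
  + (2 * (G 1 * psi 4)) * (2 * (q ^+ p * Gi p * psi (p * 4)))).
  by rewrite qp; fps_ring.
by rewrite a1 b1 (G_psiD p0) (GV_psiB p0); fps_ring.
Qed.

Lemma G_product_phi p : (0 < p)%N ->
  2 * q ^+ 0 * (psi 4 * psi (p * 4))
    * (G 1 * G p + q ^+ p.+1 * (Gi 1 * Gi p) + 0)
  = phi 1 * phi p + phi 2 * phi (p * 2).
Proof.
move=> p0; apply: fps_2_inj.
have a1 : 2 * (G 1 * psi 4) = phi 1 + phi 2 by exact: (G_psiD (d := 1) isT).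
have b1 : 2 * (q ^+ 1 * Gi 1 * psi 4) = phi 1 - phi 2 by exact: (GV_psiB (d := 1) isT).
transitivity ((2 * (G 1 * psi 4)) * (2 * (G p * psi (p * 4)))
  + (2 * (q ^+ 1 * Gi 1 * psi 4)) * (2 * (q ^+ p * Gi p * psi (p * 4)))).
  by rewrite exprS; fps_ring.
by rewrite a1 b1 (G_psiD p0) (GV_psiB p0); fps_ring.
Qed.

Lemma G_quot3_coef n : (Gi 1 * G 3) (4 * n + 5)%N = - (G 1 * Gi 3) (4 * n + 3)%N.
Proof.
apply: (@coef_opp _ _ (1 * q ^+ 1) 4 1 2);
  [|lia|by rewrite mulnC modnMDl|by rewrite (@fcoef_monomial 1) //; lia].
apply: (@vanishes_on_quot _ _ 2 1 (psi 4 * psi 12) _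
  (phi 4 * phi 12 + q ^+ 4 * (4 * psi 8 * psi 24) - phi 8 * phi 24
   + q ^+ 8 * (- (4 * psi 16 * psi 48))
   + q ^+ 1 * (2 * psi 8 * phi 12) + q ^+ 3 * (2 * phi 4 * psi 24)));
  [by in_pow|by coef0|by []| |by van].
have h := G_quotient_phi (p := 3) isT; rewrite -[(3 * 4)%N]/12%N -[(3 * 2)%N]/6%N in h.
rewrite phi2_phi6E phi1E phi3E in h.
by apply: (lincomb1 1 h); fps_ring.
Qed.

Lemma G_prod3_coef n : (G 1 * G 3) (4 * n + 6)%N = - (Gi 1 * Gi 3) (4 * n + 2)%N.
Proof.
apply: (@coef_opp _ _ (- (1 * q ^+ 2)) 4 2 4);
  [|lia|by rewrite mulnC modnMDl|by rewrite (@fcoefN_monomial 1) //; lia].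
apply: (@vanishes_on_quot _ _ 2 0 (psi 4 * psi 12) _
  (phi 4 * phi 12 + q ^+ 4 * (4 * psi 8 * psi 24) + phi 8 * phi 24
   + q ^+ 8 * (4 * psi 16 * psi 48)
   + q ^+ 1 * (2 * psi 8 * phi 12) + q ^+ 3 * (2 * phi 4 * psi 24)));
  [by in_pow|by coef0|by []| |by van].
have h := G_product_phi (p := 3) isT; rewrite -[(3 * 4)%N]/12%N -[(3 * 2)%N]/6%N in h.
rewrite phi2_phi6E phi1E phi3E in h.
by apply: (lincomb1 1 h); fps_ring.
Qed.

(* For p = 1 mod 4, a sum of two squares is never 3 mod 4. *)
Lemma phi_phi_vanish p : (0 < p)%N -> p = 1 %[mod 4] ->
  vanishes_on 4 3 (phi 1 * phi p) /\ vanishes_on 4 3 (phi 2 * phi (p * 2)).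
Proof.
move=> p0 p1; split.
  have -> : phi 1 * phi p = phi 4 * phi (p * 4) + q ^+ 1 * (2 * psi 8 * phi (p * 4))
      + q ^+ p * (2 * phi 4 * psi (p * 8)) + q ^+ p.+1 * (4 * psi 8 * psi (p * 8)).
    by rewrite (phi_split p0) phi1E (exprS q p); fps_ring.
  do !apply: vanishes_onD; [by van|by van| |]; apply: vanishes_on_shift; try in_pow.
    by rewrite p1.
  by rewrite -addn1 -modnDml p1.
by apply: (@vanishes_on_dvd _ 2) => //; apply: vanishes_on_in => //; in_pow.
Qed.

Lemma G_quot_coef p n : (0 < p)%N -> p = 1 %[mod 4] ->
  (Gi 1 * G p) (4 * n + p.+1)%N = - (G 1 * Gi p) (4 * n + 2)%N.
Proof.
move=> p0 p1; apply: (@coef_opp _ _ 0 4 2 p.-1); [|lia| |by []]; last first.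
  by rewrite mulnC modnMDl -addn1 -modnDml p1.
apply: (@vanishes_on_quot _ _ 2 1 (psi 4 * psi (p * 4)));
  [by in_pow|by rewrite fcoefM0 !psi_coef0 ?muln_gt0 ?p0|by []|exact: G_quotient_phi|].
have [h1 h2] := phi_phi_vanish p0 p1.
by apply: vanishes_onD => // k km; rewrite fcoefN h2 ?oppr0.
Qed.

Lemma G_prod_coef p n : (0 < p)%N -> p = 1 %[mod 4] ->
  (G 1 * G p) (4 * n + p.+2)%N = - (Gi 1 * Gi p) (4 * n + 1)%N.
Proof.
move=> p0 p1; apply: (@coef_opp _ _ 0 4 3 p.+1); [|lia| |by []]; last first.
  by rewrite mulnC modnMDl -addn2 -modnDml p1.
apply: (@vanishes_on_quot _ _ 2 0 (psi 4 * psi (p * 4)));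
  [by in_pow|by rewrite fcoefM0 !psi_coef0 ?muln_gt0 ?p0|by []|exact: G_product_phi|].
have [h1 h2] := phi_phi_vanish p0 p1.
exact: vanishes_onD.
Qed.

(** With A_d = phi_d phi_7d + 4 q^(2d) psi_2d psi_14d this reads A_d - A_2d = 2 q^d psi_d psi_7d.
    The value of A_d - A_4d found from [phi_split] and [psi_psi7_dil] makes the defect change sign
    when d is doubled. *)
Lemma phi_phi7 d : (0 < d)%N ->
  phi d * phi (d * 7) + 4 * q ^+ (d * 2) * psi (d * 2) * psi (d * 14)
  - (phi (d * 2) * phi (d * 14) + 4 * q ^+ (d * 4) * psi (d * 4) * psi (d * 28))
  - 2 * q ^+ d * (psi d * psi (d * 7)) = 0.
Proof.
move: d; apply: (descent (E := fun d =>
  phi d * phi (d * 7) + 4 * q ^+ (d * 2) * psi (d * 2) * psi (d * 14)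
  - (phi (d * 2) * phi (d * 14) + 4 * q ^+ (d * 4) * psi (d * 4) * psi (d * 28))
  - 2 * q ^+ d * (psi d * psi (d * 7)))) => d d0.
- have d7 : (0 < d * 7)%N by lia.
  have h7 : phi (d * 7) = phi (d * 28) + 2 * q ^+ (d * 7) * psi (d * 56).
    by rewrite (phi_split d7) -!mulnA.
  have e2 k : (d * 2 * k = d * (2 * k))%N by rewrite mulnA.
  rewrite (psi_psi7_dil d0) h7 (phi_split d0) !e2.
  rewrite -[(2 * 7)%N]/14%N -[(2 * 2)%N]/4%N -[(2 * 14)%N]/28%N -[(2 * 4)%N]/8%N
    -[(2 * 28)%N]/56%N !(exprM q d).
  by fps_ring.
- by in_pow.
- have c0 (c k : nat) (f g : fps int) : (0 < k)%N -> (c%:R * q ^+ k * f * g) 0%N = 0.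
    by move=> k0; rewrite -!mulrA fcoef_natM fcoef_varXM leqn0 (gtn_eqF k0) mulr0.
  rewrite mulrA !(fcoefB, fcoefD, c0) ?muln_gt0 ?d0 // !fcoefM0 !phi_coef0 ?muln_gt0 ?d0 //.
Qed.

Lemma G_quot7_coef n : (Gi 1 * G 7) (4 * n + 7)%N = - (G 1 * Gi 7) (4 * n + 1)%N.
Proof.
(* By [phi_phi7] at d = 4 the terms of class 0 modulo 4 in phi_1 phi_7 - phi_2 phi_14 add up to 2
   q^4 psi_4 psi_28, which is q^3 times the divisor. *)
apply: (@coef_opp _ _ (- (1 * q ^+ 3)) 4 3 6);
  [|lia|by rewrite mulnC modnMDl|by rewrite (@fcoefN_monomial 1) //; lia].
apply: (@vanishes_on_quot _ _ 2 1 (psi 4 * psi 28) _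
  (q ^+ 1 * (2 * psi 8 * phi 28) + q ^+ 7 * (2 * phi 4 * psi 56)
   + q ^+ 2 * (- (2 * psi 16 * phi 56)) + q ^+ 14 * (- (2 * phi 8 * psi 112))));
  [by in_pow|by coef0|by []| |by van].
have h := G_quotient_phi (p := 7) isT; rewrite -[(7 * 4)%N]/28%N -[(7 * 2)%N]/14%N in h.
have h7 : phi 7 = phi 28 + 2 * q ^+ 7 * psi 56 by exact: (phi_split (d := 7) isT).
have h14 : phi 14 = phi 56 + 2 * q ^+ 14 * psi 112 by exact: (phi_split (d := 14) isT).
have h4 : phi 4 * phi 28 + 4 * q ^+ 8 * psi 8 * psi 56
  - (phi 8 * phi 56 + 4 * q ^+ 16 * psi 16 * psi 112)
  - 2 * q ^+ 4 * (psi 4 * psi 28) = 0 by exact: (phi_phi7 (d := 4) isT).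
rewrite h7 h14 phi1E phi2E in h.
by apply: (lincomb2 1 1 h h4); fps_ring.
Qed.

(** By [G_double] the combination G_4/G_2 + q^2 G_2/G_4 equals G_2 - q^2/G_2 = phi_4/psi_8. *)
Lemma G_quot_double_coef n : (Gi 2 * G 4) (4 * n + 2)%N = - (G 2 * Gi 4) (4 * n)%N.
Proof.
apply: (@coef_opp _ _ 0 4 2 2); [|lia|by rewrite mulnC modnMDl|by []].
apply: (@vanishes_on_quot _ _ 1 0 (psi 8) _ (phi 4)); [by in_pow|by coef0|by []| |by van].
have h : (G 2 - q ^+ 2 * Gi 2) * psi 8 = phi 4 by exact: (G_phi2 (d := 2) isT).
have hd : G 2 ^+ 2 * (G 4 - q ^+ 2) = G 4 * (G 4 + q ^+ 2).
  exact: (G_double (d := 2) isT).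
rewrite -h; suff -> : Gi 2 * G 4 + q ^+ 2 * (G 2 * Gi 4) + 0 = G 2 - q ^+ 2 * Gi 2.
  by fps_ring.
apply: (@fps_mulI _ (G 2 * G 4)); first by rewrite fcoefM0 !G_coef0.
have e2 := GV (d := 2) isT; have e4 := GV (d := 4) isT.
transitivity (G 4 ^+ 2 + q ^+ 2 * G 2 ^+ 2).
  by apply: (lincomb2 (G 4 ^+ 2) (q ^+ 2 * G 2 ^+ 2) e2 e4); fps_ring.
by apply: (lincomb2 (-1) (q ^+ 2 * G 4) hd e2); fps_ring.
Qed.

(** * The series rho5 *)

Notation X5 := (G 2 * G 4 * Gi 1 ^+ 2).
Notation Y5 := (Gi 2 * Gi 4 * G 1 ^+ 2).

Lemma phi4V : phi 4 * (phi 4)^-1 = 1.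
Proof. by rewrite divrr // fps_unit1 // phi_coef0. Qed.

Lemma G2_phi : (G 2 + q ^+ 2 * Gi 2) * psi 8 = phi 2.
Proof. exact: (G_phi (d := 2) isT). Qed.

(** The square of [GV_psi_double], simplified by [G2_phi] and divided by psi_4^2 = phi_4 psi_8. *)
Lemma G2_GV1_sqr : G 2 * Gi 1 ^+ 2 * phi 4 = phi 2 - 2 * q * psi 8.
Proof.
apply: (@fps_mulI _ (psi 8)); first by rewrite psi_coef0.
have h : Gi 1 * psi 4 = psi 8 * (1 - q * Gi 2) by exact: (GV_psi_double (d := 1) isT).
transitivity (G 2 * (Gi 1 * psi 4) ^+ 2).
  by apply: (lincomb1 (- (G 2 * Gi 1 ^+ 2)) psi4_sqrE); fps_ring.
rewrite h; have e := GV (d := 2) isT.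
by apply: (lincomb2 (psi 8) (psi 8 ^+ 2 * (q ^+ 2 * Gi 2 - 2 * q)) G2_phi e); fps_ring.
Qed.

Lemma GV2_G1_sqr : Gi 2 * G 1 ^+ 2 * phi 4 = phi 2 + 2 * q * psi 8.
Proof.
apply: (@fps_mulI _ (psi 8)); first by rewrite psi_coef0.
have h : G 1 * psi 4 = psi 8 * (G 2 + q) by exact: (G_psi_double (d := 1) isT).
transitivity (Gi 2 * (G 1 * psi 4) ^+ 2).
  by apply: (lincomb1 (- (Gi 2 * G 1 ^+ 2)) psi4_sqrE); fps_ring.
rewrite h; have e := GV (d := 2) isT.
by apply: (lincomb2 (psi 8) (psi 8 ^+ 2 * (G 2 + 2 * q)) G2_phi e); fps_ring.
Qed.

Lemma G4_phi : (G 4 + q ^+ 4 * Gi 4) * psi 16 = phi 4.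
Proof. exact: (G_phi (d := 4) isT). Qed.

Lemma G4_phi2 : (G 4 - q ^+ 4 * Gi 4) * psi 16 = phi 8.
Proof. exact: (G_phi2 (d := 4) isT). Qed.

(** The inverse of phi_4 remains only in exponents 1 modulo 4, so the other classes can be read
    modulo 8. *)
Lemma rho5_sumE : psi 16 * (X5 + q ^+ 4 * Y5)
  = phi 8 + 2 * q ^+ 2 * psi 16 - q * (2 * psi 8 * phi 8 * (phi 4)^-1).
Proof.
apply: (@fps_mulI _ (phi 4)); first by rewrite phi_coef0.
transitivity (G 4 * psi 16 * (G 2 * Gi 1 ^+ 2 * phi 4)
  + q ^+ 4 * Gi 4 * psi 16 * (Gi 2 * G 1 ^+ 2 * phi 4)); first by fps_ring.
rewrite G2_GV1_sqr GV2_G1_sqr.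
transitivity (phi 2 * ((G 4 + q ^+ 4 * Gi 4) * psi 16)
  - 2 * q * psi 8 * ((G 4 - q ^+ 4 * Gi 4) * psi 16)); first by fps_ring.
rewrite G4_phi G4_phi2 phi2E.
by apply: (lincomb1 (2 * q * psi 8 * phi 8) phi4V); fps_ring.
Qed.

Lemma rho5_diffE : phi 4 * psi 16 * (X5 - q ^+ 4 * Y5)
  = phi 8 ^+ 2 + 2 * q ^+ 2 * psi 16 * phi 8 - 2 * q * psi 8 * phi 4.
Proof.
transitivity (G 4 * psi 16 * (G 2 * Gi 1 ^+ 2 * phi 4)
  - q ^+ 4 * Gi 4 * psi 16 * (Gi 2 * G 1 ^+ 2 * phi 4)); first by fps_ring.
rewrite G2_GV1_sqr GV2_G1_sqr.
transitivity (phi 2 * ((G 4 - q ^+ 4 * Gi 4) * psi 16)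
  - 2 * q * psi 8 * ((G 4 + q ^+ 4 * Gi 4) * psi 16)); first by fps_ring.
by rewrite G4_phi G4_phi2 phi2E; fps_ring.
Qed.

Lemma rho5_coef_2mod4 n : X5 (4 * n + 6)%N = - Y5 (4 * n + 2)%N.
Proof.
apply: (@coef_opp _ _ (- (2 * q ^+ 2)) 4 2 4);
  [|lia|by rewrite mulnC modnMDl|by rewrite fcoefN_monomial //; lia].
apply: (@vanishes_on_quot _ _ 1 0 (psi 16) _
  (phi 8 + q ^+ 1 * (- (2 * psi 8 * phi 8 * (phi 4)^-1))));
  [by in_pow|by coef0|by []| |by van].
by apply: (lincomb1 1 rho5_sumE); fps_ring.
Qed.

Lemma rho5_coef_4mod8 n : X5 (8 * n + 4)%N = - Y5 (8 * n)%N.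
Proof.
apply: (@coef_opp _ _ (- (2 * q ^+ 2)) 8 4 4);
  [|lia|by rewrite mulnC modnMDl|by rewrite fcoefN_monomial //; lia].
apply: (@vanishes_on_quot _ _ 1 0 (psi 16) _
  (phi 8 + q ^+ 1 * (- (2 * psi 8 * phi 8 * (phi 4)^-1))));
  [by in_pow|by coef0|by []| |].
  by apply: (lincomb1 1 rho5_sumE); fps_ring.
by apply: vanishes_onD; [van | apply: (@vanishes_on_dvd _ 4) => //; van].
Qed.

Lemma rho5_coef_3mod4 n : X5 (4 * n + 7)%N = Y5 (4 * n + 3)%N.
Proof.
apply: (@coef_eq _ _ 0 4 3 4); [|lia|by rewrite mulnC modnMDl|by []].
apply: (@vanishes_on_quot _ _ 1 0 (phi 4 * psi 16) _
  (phi 8 ^+ 2 + q ^+ 2 * (2 * psi 16 * phi 8) + q ^+ 1 * (- (2 * psi 8 * phi 4))));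
  [by in_pow|by coef0|by []| |by van].
by apply: (lincomb1 1 rho5_diffE); fps_ring.
Qed.

Lemma rho5_coef_5mod8 n : X5 (8 * n + 5)%N = Y5 (8 * n + 1)%N.
Proof.
apply: (@coef_eq _ _ 0 8 5 4); [|lia|by rewrite mulnC modnMDl|by []].
(* For the difference, class 1 modulo 4 is the one free of the inverse of phi_4, and q psi_8 has no
   exponent 5 modulo 8. *)
apply: (@vanishes_on_quot _ _ 1 0 (psi 16) _
  (q ^+ 1 * (- (2 * psi 8))
   + (phi 8 ^+ 2 * (phi 4)^-1 + q ^+ 2 * (2 * psi 16 * phi 8 * (phi 4)^-1))));
  [by in_pow|by coef0|by []| |].
  apply: (@fps_mulI _ (phi 4)); first by rewrite phi_coef0.
  apply: (lincomb2 1 (- (phi 8 ^+ 2 + 2 * q ^+ 2 * psi 16 * phi 8)) rho5_diffE phi4V).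
  by fps_ring.
by apply: vanishes_onD; [van | apply: (@vanishes_on_dvd _ 4) => //; van].
Qed.

Lemma rho5_sqr_coef n : (X5 ^+ 2) (8 * n + 12)%N = - (Y5 ^+ 2) (8 * n + 4)%N.
Proof.
(* X^2 + q^8 Y^2 is (X + q^4 Y)^2 - 2 q^4. A further 2 q^4 is subtracted so that the total cancels
   the square of the term 2 q^2 psi_16 in [rho5_sumE]. *)
apply: (@coef_opp _ _ (- (2 * q ^+ 4)) 8 4 8);
  [|lia|by rewrite mulnC modnMDl|by rewrite fcoefN_monomial //; lia].
pose C := 2 * psi 8 * phi 8 * (phi 4)^-1.
apply: (@vanishes_on_quot _ _ 1 0 (psi 16 * psi 16) _
  (phi 8 ^+ 2 + (q ^+ 2 * (4 * phi 8 * psi 16) + q ^+ 2 * C ^+ 2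
   + q ^+ 1 * (- (2 * phi 8 * C)) + q ^+ 3 * (- (4 * psi 16 * C)))));
  [by in_pow|by coef0|by []| |]; last first.
  by rewrite /C; apply: vanishes_onD; [van | apply: (@vanishes_on_dvd _ 4) => //; van].
have XY : X5 * Y5 = 1.
  have e1 := GV (d := 1) isT; have e2 := GV (d := 2) isT; have e4 := GV (d := 4) isT.
  transitivity ((G 2 * Gi 2) * (G 4 * Gi 4) * (G 1 * Gi 1) ^+ 2); first by fps_ring.
  by rewrite e1 e2 e4 !mul1r expr1n.
have h := rho5_sumE; rewrite -/C in h.
transitivity ((psi 16 * (X5 + q ^+ 4 * Y5)) ^+ 2 - 4 * q ^+ 4 * psi 16 ^+ 2).
  move: X5 Y5 XY => X Y XY.
  by apply: (lincomb1 (- (2 * q ^+ 4 * psi 16 ^+ 2)) XY); fps_ring.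
by rewrite {}h; move: C => C; fps_ring.
Qed.

(** * The series rho7 and rho8 *)

(** The two factors are psi_4 psi_12 and its conjugate under q^4 -> -q^4; their product is a series
    in q^8, which rationalises the divisor psi_4 psi_12 for residues modulo 8. *)
Lemma psi_psi3_conj : (phi 24 * psi 16 + q ^+ 4 * (phi 8 * psi 48))
    * (phi 24 * psi 16 - q ^+ 4 * (phi 8 * psi 48))
  = psi 8 * psi 24 * (phim 8 * phim 24).
Proof.
have h1 : psi 4 * psi 12 = phi 24 * psi 16 + q ^+ 4 * (phi 8 * psi 48).
  exact: (psi_psi3_dil (d := 4) isT).
have h2 : psim 4 * psim 12 = phi 24 * psi 16 - q ^+ 4 * (phi 8 * psi 48).
  exact: (psim_psim3 (d := 4) isT).
have h3 : psi 4 * psim 4 = psi 8 * phim 8 by exact: (psi_psim (d := 4) isT).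
have h4 : psi 12 * psim 12 = psi 24 * phim 24 by exact: (psi_psim (d := 12) isT).
rewrite -h1 -h2; transitivity ((psi 4 * psim 4) * (psi 12 * psim 12)).
  by move: (psi 4) (psi 12) (psim 4) (psim 12) => *; ring.
by rewrite h3 h4; move: (phim 8) (phim 24) => *; fps_ring.
Qed.

Lemma phim_phim3 :
  phim 8 * phim 24 = phi 8 * phi 24 - 4 * q ^+ 8 * psi 16 * psi 48.
Proof.
have h1 : phim 8 = phi 32 - 2 * q ^+ 8 * psi 64 by exact: (phim_split (d := 8) isT).
have h2 : phim 24 = phi 96 - 2 * q ^+ 24 * psi 192 by exact: (phim_split (d := 24) isT).
have h3 : phi 8 = phi 32 + 2 * q ^+ 8 * psi 64 by exact: (phi_split (d := 8) isT).
have h4 : phi 24 = phi 96 + 2 * q ^+ 24 * psi 192 by exact: (phi_split (d := 24) isT).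
have h5 : psi 16 * psi 48 = phi 96 * psi 64 + q ^+ 16 * (phi 32 * psi 192).
  exact: (psi_psi3_dil (d := 16) isT).
rewrite h1 h2 h3 h4.
by apply: (lincomb1 (4 * q ^+ 8) h5); fps_ring.
Qed.

Lemma phi4_sqrE : phi 4 ^+ 2 = phi 8 ^+ 2 + 4 * q ^+ 4 * psi 16 ^+ 2.
Proof. exact: (phi_sqr (d := 4) isT). Qed.
Lemma psi8_sqrE : psi 8 ^+ 2 = phi 8 * psi 16.
Proof. exact: (psi_sqr_dil (d := 8) isT). Qed.
Lemma phi12_sqrE : phi 12 ^+ 2 = phi 24 ^+ 2 + 4 * q ^+ 12 * psi 48 ^+ 2.
Proof. exact: (phi_sqr (d := 12) isT). Qed.
Lemma phi6_sqrE : phi 6 ^+ 2 = phi 12 ^+ 2 + 4 * q ^+ 6 * psi 24 ^+ 2.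
Proof. exact: (phi_sqr (d := 6) isT). Qed.
Lemma psi24_sqrE : psi 24 ^+ 2 = phi 24 * psi 48.
Proof. exact: (psi_sqr_dil (d := 24) isT). Qed.
Lemma psi4_psi12E : psi 4 * psi 12 = phi 24 * psi 16 + q ^+ 4 * (phi 8 * psi 48).
Proof. exact: (psi_psi3_dil (d := 4) isT). Qed.

(** [K7] is the part of X7 + 1/X7 - 1 with exponents divisible by 4, and q [L8] the part of X8 +
    q^10/X8 + q^5 with exponents 1 modulo 4. *)
Notation K7 := (phi 4 ^+ 2 * psi 24 * (psi 4 * psi 12 * psi 8)^-1).
Notation L8 := (phi 12 ^+ 2 * psi 8 * (psi 4 * psi 12 * psi 24)^-1).

(** After rationalising, [K7] - 1 becomes q^4 times a series in q^8: the constant 1 is all that [K7]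
    has in class 0 modulo 8. *)
Lemma K7_even : vanishes_on 8 0 (K7 - 1).
Proof.
apply: (@vanishes_on_quot _ _ 1 0 (psi 8 * psi 8 * psi 24 * (phim 8 * phim 24)) _
  (q ^+ 4 * (psi 24 * (4 * psi 16 ^+ 3 * phi 24 - phi 8 ^+ 3 * psi 48))));
  [by rewrite phim_phim3; in_pow|by coef0|by []| |by van].
have v : psi 4 * psi 12 * psi 8 * (psi 4 * psi 12 * psi 8)^-1 = 1.
  by rewrite divrr // fps_unit1 //; coef0.
have kv : K7 * (psi 4 * psi 12 * psi 8) = phi 4 ^+ 2 * psi 24.
  by apply: (lincomb1 (phi 4 ^+ 2 * psi 24) v); fps_ring.
move: kv; set K := K7; rewrite psi4_psi12E => kv.
have hW := psi_psi3_conj; have hM := phim_phim3.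
set W := phim 8 * phim 24 in hW hM *; set D' := phi 24 * psi 16 - _ in hW.
transitivity (K * (psi 8 * (psi 8 * psi 24 * W)) - psi 8 ^+ 2 * psi 24 * W).
  by move: (K) (W) => *; fps_ring.
rewrite -hW.
transitivity ((K * ((phi 24 * psi 16 + q ^+ 4 * (phi 8 * psi 48)) * psi 8)) * D'
   - psi 8 ^+ 2 * psi 24 * W); first by move: (K) (W) (D') => *; fps_ring.
by rewrite kv phi4_sqrE psi8_sqrE hM /D'; fps_ring.
Qed.

(** Same computation as for [K7]: the only term of [L8] in class 4 modulo 8 is -q^4. *)
Lemma L8_odd : vanishes_on 8 4 (L8 + q ^+ 4).
Proof.
apply: (@vanishes_on_quot _ _ 1 0 (psi 8 * psi 24 * psi 24 * (phim 8 * phim 24)) _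
  (psi 8 * (phi 24 ^+ 3 * psi 16 - 4 * q ^+ 16 * psi 48 ^+ 3 * phi 8)));
  [by rewrite phim_phim3; in_pow|by coef0|by []| |by van].
have v : psi 4 * psi 12 * psi 24 * (psi 4 * psi 12 * psi 24)^-1 = 1.
  by rewrite divrr // fps_unit1 //; coef0.
have kv : L8 * (psi 4 * psi 12 * psi 24) = phi 12 ^+ 2 * psi 8.
  by apply: (lincomb1 (phi 12 ^+ 2 * psi 8) v); fps_ring.
move: kv; set K := L8; rewrite psi4_psi12E => kv.
have hW := psi_psi3_conj; have hM := phim_phim3.
set W := phim 8 * phim 24 in hW hM *; set D' := phi 24 * psi 16 - _ in hW.
transitivity (K * (psi 24 * (psi 8 * psi 24 * W)) + q ^+ 4 * psi 8 * psi 24 ^+ 2 * W).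
  by move: (K) (W) => *; fps_ring.
rewrite -hW.
transitivity ((K * ((phi 24 * psi 16 + q ^+ 4 * (phi 8 * psi 48)) * psi 24)) * D'
   + q ^+ 4 * psi 8 * psi 24 ^+ 2 * W); first by move: (K) (W) (D') => *; fps_ring.
by rewrite kv phi12_sqrE psi24_sqrE hM /D'; fps_ring.
Qed.

Notation X7 := (G 1 * G 3 * Gi 2 ^+ 2).
Notation Y7 := (Gi 1 * Gi 3 * G 2 ^+ 2).
Notation X8 := (G 1 * G 6 ^+ 2 * Gi 3).
Notation Y8 := (Gi 1 * Gi 6 ^+ 2 * G 3).

(** The factors q q^3 and (q^2)^2 that accompany the inverses are both q^4, so no power of q
    separates X7 from Y7. *)
Lemma rho7_phi : 16 * q ^+ 4 * (psi 4 * psi 12 * psi 8 * psi 8) * (X7 + Y7)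
  = 2 * ((phi 2 ^+ 2 + phi 4 ^+ 2) * (phi 1 * phi 3 + phi 2 * phi 6)
         - 2 * phi 4 * (phi 2 ^+ 2 * phi 3 + phi 1 * (phi 2 * phi 6))).
Proof.
have a1 : 2 * (G 1 * psi 4) = phi 1 + phi 2 by exact: (G_psiD (d := 1) isT).
have b1 : 2 * (q ^+ 1 * Gi 1 * psi 4) = phi 1 - phi 2 by exact: (GV_psiB (d := 1) isT).
have a2 : 2 * (G 2 * psi 8) = phi 2 + phi 4 by exact: (G_psiD (d := 2) isT).
have b2 : 2 * (q ^+ 2 * Gi 2 * psi 8) = phi 2 - phi 4 by exact: (GV_psiB (d := 2) isT).
have a3 : 2 * (G 3 * psi 12) = phi 3 + phi 6 by exact: (G_psiD (d := 3) isT).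
have b3 : 2 * (q ^+ 3 * Gi 3 * psi 12) = phi 3 - phi 6 by exact: (GV_psiB (d := 3) isT).
transitivity ((2 * (G 1 * psi 4)) * (2 * (G 3 * psi 12)) * (2 * (q ^+ 2 * Gi 2 * psi 8)) ^+ 2
  + (2 * (q ^+ 1 * Gi 1 * psi 4)) * (2 * (q ^+ 3 * Gi 3 * psi 12))
    * (2 * (G 2 * psi 8)) ^+ 2); first by fps_ring.
by rewrite a1 b1 a2 b2 a3 b3; fps_ring.
Qed.

Lemma rho7_coef n : (0 < n)%N -> X7 (8 * n)%N = - Y7 (8 * n)%N.
Proof.
(* The constant 2 is made of the constant term of [K7] and the 1 beside it; it sits at exponent 0,
   hence n > 0. *)
move=> n0; apply: (@coef_opp _ _ (- (2 * q ^+ 0)) 8 0 0);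
  [|lia|by rewrite modnMr mod0n|by rewrite fcoefN_monomial //; lia].
have -> : X7 + q ^+ 0 * Y7 - 2 * q ^+ 0 = (X7 + Y7 - 1 - K7) + (K7 - 1).
  by rewrite expr0; fps_ring.
apply: vanishes_onD; last exact: K7_even.
apply: (@vanishes_on_dvd _ 4) => //.
apply: (@vanishes_on_quot _ _ 16 4 (psi 4 * psi 12 * psi 8 * psi 8) _
  (q ^+ 1 * (8 * phi 4 ^+ 2 * psi 8 * phi 12 - 16 * q ^+ 4 * phi 4 * psi 8 ^+ 2 * psi 24
     - 8 * phi 4 * psi 8 * (phi 8 * phi 24 + 4 * q ^+ 8 * psi 16 * psi 48))
   + q ^+ 2 * (8 * psi 8 ^+ 2 * (4 * q ^+ 4 * psi 8 * psi 24
     + (phi 8 * phi 24 + 4 * q ^+ 8 * psi 16 * psi 48) - phi 4 * phi 12))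
   + q ^+ 3 * (16 * psi 8 ^+ 3 * phi 12 - 16 * phi 4 * psi 8 * (psi 4 * psi 12))));
  [by in_pow|by coef0|by []| |by van].
have v : psi 4 * psi 12 * psi 8 * (psi 4 * psi 12 * psi 8)^-1 = 1.
  by rewrite divrr // fps_unit1 //; coef0.
have h := rho7_phi; rewrite phi2_sqrE phi2_phi6E phi1E phi3E in h.
by apply: (lincomb2 1 (- (16 * q ^+ 4 * psi 8 * phi 4 ^+ 2 * psi 24)) h v); fps_ring.
Qed.

Lemma rho8_phi : 16 * q ^+ 3 * (psi 4 * psi 12 * psi 24 * psi 24) * (X8 + q ^+ 10 * Y8)
  = 2 * ((phi 6 ^+ 2 + phi 12 ^+ 2) * (phi 1 * phi 3 - phi 2 * phi 6)
         + 2 * phi 12 * (phi 2 * phi 6 * phi 3 - phi 1 * phi 6 ^+ 2)).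
Proof.
have a1 : 2 * (G 1 * psi 4) = phi 1 + phi 2 by exact: (G_psiD (d := 1) isT).
have b1 : 2 * (q ^+ 1 * Gi 1 * psi 4) = phi 1 - phi 2 by exact: (GV_psiB (d := 1) isT).
have a6 : 2 * (G 6 * psi 24) = phi 6 + phi 12 by exact: (G_psiD (d := 6) isT).
have b6 : 2 * (q ^+ 6 * Gi 6 * psi 24) = phi 6 - phi 12 by exact: (GV_psiB (d := 6) isT).
have a3 : 2 * (G 3 * psi 12) = phi 3 + phi 6 by exact: (G_psiD (d := 3) isT).
have b3 : 2 * (q ^+ 3 * Gi 3 * psi 12) = phi 3 - phi 6 by exact: (GV_psiB (d := 3) isT).
transitivity ((2 * (G 1 * psi 4)) * (2 * (q ^+ 3 * Gi 3 * psi 12)) * (2 * (G 6 * psi 24)) ^+ 2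
  + (2 * (q ^+ 1 * Gi 1 * psi 4)) * (2 * (G 3 * psi 12))
    * (2 * (q ^+ 6 * Gi 6 * psi 24)) ^+ 2); first by fps_ring.
by rewrite a1 b1 a6 b6 a3 b3; fps_ring.
Qed.

Lemma rho8_coef n : X8 (8 * n + 13)%N = - Y8 (8 * n + 3)%N.
Proof.
apply: (@coef_opp _ _ (2 * q ^+ 5) 8 5 10);
  [|lia|by rewrite mulnC modnMDl|by rewrite fcoef_monomial //; lia].
have -> : X8 + q ^+ 10 * Y8 + 2 * q ^+ 5
    = (X8 + q ^+ 10 * Y8 + q ^+ 5 - q * L8) + q ^+ 1 * (L8 + q ^+ 4) by fps_ring.
apply: vanishes_onD; last first.
  move=> m m5; rewrite fcoef_varXM; case: m m5 => // m m5 /=; rewrite subn1.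
  by apply: L8_odd; apply/eqP; rewrite -(eqn_modDr 1) addn1; apply/eqP.
apply: (@vanishes_on_dvd _ 4) => //.
apply: (@vanishes_on_quot _ _ 16 3 (psi 4 * psi 12 * psi 24 * psi 24) _
  (q ^+ 1 * (2 * (4 * psi 8 * phi 12 ^+ 3 + 8 * q ^+ 8 * phi 4 * psi 24 ^+ 3
      + 8 * q ^+ 4 * phi 12 * (psi 4 * psi 12) * psi 24 - 4 * psi 8 * phi 12 ^+ 3))
   + q ^+ 2 * (2 * (4 * q ^+ 4 * psi 24 ^+ 2 * (phi 4 * phi 12 + 4 * q ^+ 4 * psi 8 * psi 24
        - (phi 8 * phi 24 + 4 * q ^+ 8 * psi 16 * psi 48))
      - 8 * q ^+ 4 * phi 12 * phi 4 * psi 24 ^+ 2))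
   + q ^+ 3 * (2 * (4 * phi 4 * phi 12 ^+ 2 * psi 24 + 8 * q ^+ 4 * psi 8 * phi 12 * psi 24 ^+ 2
      + 4 * phi 12 * psi 24 * (phi 8 * phi 24 + 4 * q ^+ 8 * psi 16 * psi 48)
      - 16 * q ^+ 4 * phi 12 * psi 8 * psi 24 ^+ 2))));
  [by in_pow|by coef0|by []| |by van].
have v : psi 4 * psi 12 * psi 24 * (psi 4 * psi 12 * psi 24)^-1 = 1.
  by rewrite divrr // fps_unit1 //; coef0.
have h := rho8_phi; rewrite phi6_sqrE phi2_phi6E phi1E phi3E in h.
by apply: (lincomb2 1 (- (16 * q ^+ 4 * psi 24 * phi 12 ^+ 2 * psi 8)) h v); fps_ring.
Qed.

(** * From the rho series to monomials in G *)

Lemma div_mul2 (a b a' b' : fps int) :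
  a' \is a GRing.unit -> b' \is a GRing.unit ->
  (a * b) / (a' * b') = (a / a') * (b / b').
Proof. by move=> ua ub; rewrite invrM // [b'^-1 * _]mulrC mulrACA. Qed.

Lemma div_mul3 (a b c a' b' c' : fps int) :
  a' \is a GRing.unit -> b' \is a GRing.unit -> c' \is a GRing.unit ->
  (a * b * c) / (a' * b' * c') = (a / a') * (b / b') * (c / c').
Proof. by move=> ua ub uc; rewrite div_mul2 ?unitrM ?ua // div_mul2. Qed.

Lemma div_mul3C (a b c a' b' c' : fps int) :
  a' \is a GRing.unit -> b' \is a GRing.unit -> c' \is a GRing.unit ->
  (a * b * c) / (b' * a' * c') = (a / a') * (b / b') * (c / c').
Proof. by move=> ua ub uc; rewrite [b' * a']mulrC div_mul3. Qed.

Lemma div_expr3 (a b c a' b' c' : fps int) k :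
  (a ^+ k * b ^+ k * c ^+ k) / (a' ^+ k * b' ^+ k * c' ^+ k)
    = ((a * b * c) / (a' * b' * c')) ^+ k.
Proof. by rewrite -!exprMn -exprVn -exprMn. Qed.

Lemma GE d : RGG_S (q ^+ d) / RGG_T (q ^+ d) = G d.
Proof. by rewrite G.unlock. Qed.

Lemma GiE d : (0 < d)%N -> RGG_T (q ^+ d) / RGG_S (q ^+ d) = Gi d.
Proof.
move=> d0; have [uS uT] := RGG_unit (varX_coef0 d0).
rewrite -GE; apply/esym/mulr1_eq.
by move: uS uT; move: (RGG_S _) (RGG_T _) => s t us ut; rewrite mulrA divrK // divrr.
Qed.

Lemma RGG_neg_unit d : (0 < d)%N ->
  (RGG_S (- q ^+ d) \is a GRing.unit) * (RGG_T (- q ^+ d) \is a GRing.unit).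
Proof. by move=> d0; apply: RGG_unit; rewrite fcoefN varX_coef0 ?oppr0. Qed.

Lemma GiE_neg d : odd d ->
  RGG_T (- q ^+ d) / RGG_S (- q ^+ d) = G d / G (d * 2).
Proof.
move=> od; have d0 : (0 < d)%N by case: d od.
have [uS uT] := RGG_neg_unit d0; have h := G_neg od.
have ug := G_unit d0; have ug2 : G (d * 2) \is a GRing.unit by apply: G_unit; lia.
have -> : RGG_T (- q ^+ d) / RGG_S (- q ^+ d)
    = (RGG_S (- q ^+ d) / RGG_T (- q ^+ d))^-1.
  move: uS uT; move: (RGG_S _) (RGG_T _) => s t us ut.
  by apply/esym/mulr1_eq; rewrite mulrA divrK // divrr.
by rewrite h; apply: mulr1_eq; rewrite mulrA divrK // divrr.
Qed.

Lemma rho1E k : (rho1 k = G 1 ^+ k) * ((rho1 k)^-1 = Gi 1 ^+ k).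
Proof.
have e : rho1 k = G 1 ^+ k by rewrite -GE exprMn exprVn expr1.
by split; rewrite // e exprVn.
Qed.

Lemma rho2E k : (0 < k)%N ->
  (rho2 k = Gi 1 * G k) * ((rho2 k)^-1 = G 1 * Gi k).
Proof.
move=> k0; have e : rho2 k = Gi 1 * G k.
  have [uS _] := RGG_unit (varX_coef0 (d := 1) isT).
  have [_ uT] := RGG_unit (varX_coef0 k0).
  have hi := GiE (d := 1) isT; have hk := GE k; rewrite !expr1 in uS hi.
  exact: (etrans (div_mul2 _ _ uS uT) (congr2 *%R hi hk)).
split=> //; rewrite e; apply: mulr1_eq.
transitivity ((G 1 * Gi 1) * (G k * Gi k)); first by fps_ring.
by rewrite !GV ?mulr1.
Qed.

Lemma rho3E k : (0 < k)%N ->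
  (rho3 k = G 1 * G k) * ((rho3 k)^-1 = Gi 1 * Gi k).
Proof.
move=> k0; have e : rho3 k = G 1 * G k.
  have [_ uS] := RGG_unit (varX_coef0 (d := 1) isT).
  have [_ uT] := RGG_unit (varX_coef0 k0).
  have h1 := GE 1; have hk := GE k; rewrite !expr1 in uS h1.
  exact: (etrans (div_mul2 _ _ uS uT) (congr2 *%R h1 hk)).
split=> //; rewrite e; apply: mulr1_eq.
transitivity ((G 1 * Gi 1) * (G k * Gi k)); first by fps_ring.
by rewrite !GV ?mulr1.
Qed.

Lemma rho4E : (rho4 = Gi 2 * G 4) * (rho4^-1 = G 2 * Gi 4).
Proof.
have e : rho4 = Gi 2 * G 4.
  have [uS _] := RGG_unit (varX_coef0 (d := 2) isT).
  have [_ uT] := RGG_unit (varX_coef0 (d := 4) isT).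
  have hi := GiE (d := 2) isT; have h4 := GE 4.
  exact: (etrans (div_mul2 _ _ uS uT) (congr2 *%R hi h4)).
split=> //; rewrite e; apply: mulr1_eq.
transitivity ((G 2 * Gi 2) * (G 4 * Gi 4)); first by fps_ring.
by rewrite !GV ?mulr1.
Qed.

Lemma rho5E k : (rho5 k = X5 ^+ k) * ((rho5 k)^-1 = Y5 ^+ k).
Proof.
have e : rho5 k = X5 ^+ k.
  have [uS _] := RGG_unit (varX_coef0 (d := 1) isT).
  have [_ uTm] := RGG_neg_unit (d := 1) isT.
  have [_ uT] := RGG_unit (varX_coef0 (d := 4) isT).
  have hm := G_neg (d := 1) isT; have hi := GiE (d := 1) isT; have h4 := GE 4.
  rewrite mul1n in hm; rewrite !expr1 in uS uTm hm hi.
  apply: (etrans (div_expr3 _ _ _ _ _ _ k)); congr (_ ^+ k).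
  have h := etrans (div_mul3C _ _ _ uTm uS uT) (congr2 *%R (congr2 *%R hm hi) h4).
  by apply: etrans h _; fps_ring.
split=> //; rewrite e -exprVn; congr (_ ^+ k); apply: mulr1_eq.
transitivity ((G 1 * Gi 1) ^+ 2 * (G 2 * Gi 2) * (G 4 * Gi 4)); first by fps_ring.
by rewrite !GV // expr1n !mulr1.
Qed.

(** G(-q) = G_2/G_1 absorbs the factor 1/G_2, so [rho6] coincides with [rho2 3]. *)
Lemma rho6E : (rho6 = Gi 1 * G 3) * (rho6^-1 = G 1 * Gi 3).
Proof.
have e : rho6 = Gi 1 * G 3.
  have [_ uTm] := RGG_neg_unit (d := 1) isT.
  have [uS _] := RGG_unit (varX_coef0 (d := 2) isT).
  have [_ uT] := RGG_unit (varX_coef0 (d := 3) isT).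
  have hm := G_neg (d := 1) isT; have hi := GiE (d := 2) isT; have h3 := GE 3.
  rewrite mul1n in hm; rewrite !expr1 in uTm hm.
  have h := etrans (div_mul3 _ _ _ uTm uS uT) (congr2 *%R (congr2 *%R hm hi) h3).
  apply: etrans h _.
  by apply: (lincomb1 (Gi 1 * G 3) (GV (d := 2) isT)); fps_ring.
by have := rho2E (k := 3) isT; rewrite e => -[-> ->].
Qed.

Lemma rho7E : (rho7 = X7) * (rho7^-1 = Y7).
Proof.
have e : rho7 = X7.
  have [uSm _] := RGG_neg_unit (d := 1) isT.
  have [uS _] := RGG_unit (varX_coef0 (d := 2) isT).
  have [_ uT] := RGG_unit (varX_coef0 (d := 3) isT).
  have hm := GiE_neg (d := 1) isT; have hi := GiE (d := 2) isT; have h3 := GE 3.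
  rewrite mul1n in hm; rewrite !expr1 in uSm hm.
  have h := etrans (div_mul3 _ _ _ uSm uS uT) (congr2 *%R (congr2 *%R hm hi) h3).
  by apply: etrans h _; fps_ring.
split=> //; rewrite e; apply: mulr1_eq.
transitivity ((G 1 * Gi 1) * (G 3 * Gi 3) * (G 2 * Gi 2) ^+ 2); first by fps_ring.
by rewrite !GV // expr1n !mulr1.
Qed.

Lemma rho8E : (rho8 = X8) * (rho8^-1 = Y8).
Proof.
have e : rho8 = X8.
  have [_ uTm] := RGG_neg_unit (d := 3) isT.
  have [_ uT] := RGG_unit (varX_coef0 (d := 1) isT).
  have [_ uT'] := RGG_unit (varX_coef0 (d := 6) isT).
  have hm : RGG_S (- q ^+ 3) / RGG_T (- q ^+ 3) = G 6 / G 3.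
    exact: (G_neg (d := 3) isT).
  have h1 := GE 1; have h6 := GE 6; rewrite expr1 in uT h1.
  have h := etrans (div_mul3 _ _ _ uT uTm uT') (congr2 *%R (congr2 *%R h1 hm) h6).
  by apply: etrans h _; fps_ring.
split=> //; rewrite e; apply: mulr1_eq.
transitivity ((G 1 * Gi 1) * (G 3 * Gi 3) * (G 6 * Gi 6) ^+ 2); first by fps_ring.
by rewrite !GV // expr1n !mulr1.
Qed.

(** Here G_6 cancels, so [rho9] coincides with [rho3 3]. *)
Lemma rho9E : (rho9 = G 1 * G 3) * (rho9^-1 = Gi 1 * Gi 3).
Proof.
have e : rho9 = G 1 * G 3.
  have [uSm _] := RGG_neg_unit (d := 3) isT.
  have [_ uT] := RGG_unit (varX_coef0 (d := 1) isT).
  have [_ uT'] := RGG_unit (varX_coef0 (d := 6) isT).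
  have hm : RGG_T (- q ^+ 3) / RGG_S (- q ^+ 3) = G 3 / G 6.
    exact: (GiE_neg (d := 3) isT).
  have h1 := GE 1; have h6 := GE 6; rewrite expr1 in uT h1.
  have h := etrans (div_mul3 _ _ _ uT uSm uT') (congr2 *%R (congr2 *%R h1 hm) h6).
  apply: etrans h _.
  by apply: (lincomb1 (G 1 * G 3) (GV (d := 6) isT)); fps_ring.
by have := rho3E (k := 3) isT; rewrite e => -[-> ->].
Qed.

(* Two items of the source are false as printed and appear here corrected:
   - (vi) is printed  rho_{1,4}(4n+6) = rho'_{1,2}(4n+2),  which at n = 0 reads
     -6 = 1; the identity stated is  rho_{1,4}(4n+6) = - rho'_{1,4}(4n+2).
   - (xxi) is printed for all n >= 0, but at n = 0 both coefficients are 1;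
     it is stated for n >= 1. *)
Theorem theorem1p5 (n : nat) :
  (* i *)      rho1 1 (2 * n + 1)%N = ((rho1 1)^-1) (2 * n)%N /\
  (* ii *)     rho1 1 (4 * n + 2)%N = - ((rho1 1)^-1) (4 * n + 1)%N /\
  (* iii *)    rho1 2 (2 * n + 3)%N = - ((rho1 2)^-1) (2 * n + 1)%N /\
  (* iv *)     rho1 2 (8 * n + 4)%N = ((rho1 2)^-1) (8 * n + 2)%N /\
  (* v *)      rho1 2 (8 * n + 6)%N = ((rho1 2)^-1) (8 * n + 4)%N /\
  (* vi *)     rho1 4 (4 * n + 6)%N = - ((rho1 4)^-1) (4 * n + 2)%N /\
  (* vii *)    rho2 3 (4 * n + 5)%N = - ((rho2 3)^-1) (4 * n + 3)%N /\
  (* viii *)   rho2 5 (4 * n + 6)%N = - ((rho2 5)^-1) (4 * n + 2)%N /\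
  (* ix *)     rho2 7 (4 * n + 7)%N = - ((rho2 7)^-1) (4 * n + 1)%N /\
  (* x *)      rho2 9 (4 * n + 10)%N = - ((rho2 9)^-1) (4 * n + 2)%N /\
  (* xi *)     rho3 3 (4 * n + 6)%N = - ((rho3 3)^-1) (4 * n + 2)%N /\
  (* xii *)    rho3 5 (4 * n + 7)%N = - ((rho3 5)^-1) (4 * n + 1)%N /\
  (* xiii *)   rho3 9 (4 * n + 11)%N = - ((rho3 9)^-1) (4 * n + 1)%N /\
  (* xiv *)    rho4 (4 * n + 2)%N = - (rho4^-1) (4 * n)%N /\
  (* xv *)     rho5 1 (4 * n + 6)%N = - ((rho5 1)^-1) (4 * n + 2)%N /\
  (* xvi *)    rho5 1 (4 * n + 7)%N = ((rho5 1)^-1) (4 * n + 3)%N /\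
  (* xvii *)   rho5 1 (8 * n + 4)%N = - ((rho5 1)^-1) (8 * n)%N /\
  (* xviii *)  rho5 1 (8 * n + 5)%N = ((rho5 1)^-1) (8 * n + 1)%N /\
  (* xix *)    rho5 2 (8 * n + 12)%N = - ((rho5 2)^-1) (8 * n + 4)%N /\
  (* xx *)     rho6 (4 * n + 5)%N = - (rho6^-1) (4 * n + 3)%N /\
  (* xxi *)    ((0 < n)%N -> rho7 (8 * n)%N = - (rho7^-1) (8 * n)%N) /\
  (* xxii *)   rho8 (8 * n + 13)%N = - (rho8^-1) (8 * n + 3)%N /\
  (* xxiii *)  rho9 (4 * n + 6)%N = - (rho9^-1) (4 * n + 2)%N.
Proof.

split; first by have [e e'] := rho1E 1; rewrite e' e !expr1; exact: G_coef_odd.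
split; first by have [e e'] := rho1E 1; rewrite e' e !expr1; exact: G_coef_mod4.
split; first by have [e e'] := rho1E 2; rewrite e' e; exact: Gsqr_coef_odd.
split; first by have [e e'] := rho1E 2; rewrite e' e; exact: (@Gsqr_coef_mod8 n 4).
split; first by have [e e'] := rho1E 2; rewrite e' e; exact: (@Gsqr_coef_mod8 n 6).
split; first by have [e e'] := rho1E 4; rewrite e' e; exact: G_exp4_coef.
split; first by have [e e'] := rho2E (k := 3) isT; rewrite e' e; exact: G_quot3_coef.
split; first by have [e e'] := rho2E (k := 5) isT; rewrite e' e; exact: (@G_quot_coef 5).
split; first by have [e e'] := rho2E (k := 7) isT; rewrite e' e; exact: G_quot7_coef.
split; first by have [e e'] := rho2E (k := 9) isT; rewrite e' e; exact: (@G_quot_coef 9).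
split; first by have [e e'] := rho3E (k := 3) isT; rewrite e' e; exact: G_prod3_coef.
split; first by have [e e'] := rho3E (k := 5) isT; rewrite e' e; exact: (@G_prod_coef 5).
split; first by have [e e'] := rho3E (k := 9) isT; rewrite e' e; exact: (@G_prod_coef 9).
split; first by have [e e'] := rho4E; rewrite e' e; exact: G_quot_double_coef.
split; first by have [e e'] := rho5E 1; rewrite e' e !expr1; exact: rho5_coef_2mod4.
split; first by have [e e'] := rho5E 1; rewrite e' e !expr1; exact: rho5_coef_3mod4.
split; first by have [e e'] := rho5E 1; rewrite e' e !expr1; exact: rho5_coef_4mod8.
split; first by have [e e'] := rho5E 1; rewrite e' e !expr1; exact: rho5_coef_5mod8.
split; first by have [e e'] := rho5E 2; rewrite e' e; exact: rho5_sqr_coef.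
split; first by have [e e'] := rho6E; rewrite e' e; exact: G_quot3_coef.
split; first by have [e e'] := rho7E; rewrite e' e; exact: rho7_coef.
split; first by have [e e'] := rho8E; rewrite e' e; exact: rho8_coef.
by have [e e'] := rho9E; rewrite e' e; exact: G_prod3_coef.
Qed.
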